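(* Let $m$ be a positive integer and let $\lambda$ be a (positive) partition with conjugate $\lambda'$, such that $\ell(\lambda)=\lambda'_1\le m$. Let $L=\lambda_1$ be the largest part of $\lambda$. Then $$ \mathbb{F}_{\lambda}(x_1,\dots,x_m) = \oint_{\mathcal{C}} \frac{du_1}{2\pi\mathrm{i}\, u_1} \cdots \oint_{\mathcal{C}} \frac{du_L}{2\pi\mathrm{i}\, u_L} \prod_{1 \leq i<j \leq L} \left(\frac{u_i-u_j}{u_i-q u_j}\right) \prod_{i=1}^{L} \left(\frac{1-su_i}{u_i-s}\right)^{\lambda'_i} \left(\frac{\prod_{j=1}^{m}(1+u_i x_j)}{(1-s u_i)^{m+1}}\right), $$ where all integrations are along the same positively oriented closed contour $\mathcal{C}$ such that: the point $s^{-1}$ lies outside $\mathcal{C}$; the point $0$ and all points $sq^i$, $i\in\mathbb{Z}_{\ge0}$, lie inside $\mathcal{C}$; and the image $q\mathcal{C}$ of $\mathcal{C}$ under multiplication by $q$ lies completely inside $\mathcal{C}$.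
   Context: Fix $q,s\in\mathbb{C}$ with $|q|<1$, $|s|<1$. Write $(a;q)_m=\prod_{i=1}^m(1-aq^{i-1})$ for $m\ge 1$, $(a;q)_0=1$, $(a;q)_\infty=\prod_{i\ge1}(1-aq^{i-1})$. A (positive) partition is a finite, possibly empty, sequence $\lambda_1\ge\dots\ge\lambda_\ell\ge1$ of integers; $\ell(\lambda)=\ell$; $\lambda_i:=0$ for $i>\ell(\lambda)$; the conjugate $\lambda'$ has parts $\lambda'_i=\#\{j:\lambda_j\ge i\}$. Vertex weights: for $x\in\mathbb{C}$ and $i,j,k,\ell\in\mathbb{Z}_{\ge0}$, $$W_x(i,j;k,\ell)=\mathbf 1_{i+j=k+\ell}\,\mathbf 1_{i\ge\ell}\;x^\ell\frac{(-s/x;q)_\ell\,(-sx;q)_{i-\ell}\,(q;q)_k}{(q;q)_\ell\,(q;q)_{i-\ell}\,(s^2;q)_k},$$ where $x^\ell(-s/x;q)_\ell$ is read as the polynomial $\prod_{r=0}^{\ell-1}(x+sq^r)$. ($i,j,k,\ell$ are the numbers of paths on the bottom, left, top, right edges of the vertex.) Spin $q$-Whittaker polynomial: for a partition $\lambda$, $$\mathbb{F}_{\lambda}(x_1,\dots,x_m)=\sum\prod_{r=1}^m\left[x_r^{h_{r,0}}\frac{(-s/x_r;q)_{h_{r,0}}}{(q;q)_{h_{r,0}}}\prod_{c\ge1}W_{x_r}\big(v_{r-1,c},h_{r,c-1};v_{r,c},h_{r,c}\big)\right],$$ the sum running over all non-negative integers $h_{r,c}$ ($1\le r\le m$, $c\ge0$),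 with $h_{r,c}=0$ for all large $c$, and $v_{r,c}$ ($0\le r\le m$, $c\ge1$) subject to $v_{0,c}=0$ and $v_{m,c}=\lambda_c-\lambda_{c+1}$; all but finitely many vertex weights equal $W_x(0,0;0,0)=1$ in any nonzero term. (Equivalently: the partition function on columns $0,1,2,\dots$ and rows $1,\dots,m$ numbered from bottom to top, row $r$ carrying $x_r$, all left and right boundary edges empty, infinitely many paths in column $0$ with weights $W_x(\infty,0;\infty,\ell)=x^\ell\frac{(-s/x;q)_\ell(-sx;q)_\infty}{(q;q)_\ell(s^2;q)_\infty}$, divided by $\prod_{i=1}^m(-sx_i;q)_\infty/(s^2;q)_\infty$.) *)

(* Defs.v *)
From HB Require Import structures.
From mathcomp Require Import all_boot all_order all_algebra.
From mathcomp Require Import all_classical all_reals all_analysis.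
From mathcomp Require Import complex.

Set Implicit Arguments.
Unset Strict Implicit.
Unset Printing Implicit Defensive.

Import Order.TTheory GRing.Theory Num.Theory.
Import numFieldNormedType.Exports.

Local Open Scope classical_set_scope.
Local Open Scope complex_scope.
Local Open Scope ring_scope.

(** Integer partitions, as weakly decreasing sequences of positive integers;
    parts are numbered from 0, so that [nth 0 la c] is lambda_(c+1) and [conj_part la i] is
    lambda'_(i+1). *)

Definition is_partition (la : seq nat) : bool :=
  sorted geq la && (0%N \notin la).

Definition conj_part (la : seq nat) (i : nat) : nat :=
  count (fun p => (i < p)%N) la.

Section SpinqWhittaker.
Variables (R : realType) (q s : R[i]).

Definition qpoch (a : R[i]) (n : nat) : R[i] :=
  \prod_(i < n) (1 - a * q ^+ i).

(** The polynomial x^n (-s/x; q)_n. *)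
Definition xpoch (x : R[i]) (n : nat) : R[i] :=
  \prod_(r < n) (x + s * q ^+ r).

Definition vweight (x : R[i]) (i j k l : nat) : R[i] :=
  if (i + j == k + l)%N && (l <= i)%N then
    xpoch x l * qpoch (- s * x) (i - l) * qpoch q k
    / (qpoch q l * qpoch q (i - l) * qpoch (s ^+ 2) k)
  else 0.

(** A limit in [R[i]] of the finite products: a non-conserving vertex makes
    the infinite product vanish. *)
Definition inf_prod (f : nat -> R[i]) : R[i] :=
  lim ((fun n => \prod_(c < n) f c : R[i]^o) @ \oo).

(** Edge occupation numbers on [m] rows.  Rows are numbered from 0 for
    horizontal edges: [h r c] is h_(r+1,c), whereas [v r c] is v_(r,c+1). *)
Definition hconf (m : nat) := 'I_m -> nat -> nat.
Definition vconf (m : nat) := 'I_m.+1 -> nat -> nat.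

Definition admissible (m : nat) (la : seq nat) : set (hconf m * vconf m) :=
  [set hv | [/\ forall r, \forall c \near \oo, hv.1 r c = 0%N,
                forall c, hv.2 ord0 c = 0%N
              & forall c, hv.2 ord_max c = (nth 0 la c - nth 0 la c.+1)%N]].

Definition conf_weight (m : nat) (x : 'I_m -> R[i])
    (hv : hconf m * vconf m) : R[i] :=
  let: (h, v) := hv in
  \prod_(r < m)
    (xpoch (x r) (h r 0%N) / qpoch q (h r 0%N) *
     inf_prod (fun c => vweight (x r) (v (widen_ord (leqnSn m) r) c) (h r c)
                                      (v (lift ord0 r) c) (h r c.+1))).

Definition spin_qWhittaker (m : nat) (la : seq nat) (x : 'I_m -> R[i]) : R[i] :=
  \sum_(hv \in @admissible m la) conf_weight x hv.

End SpinqWhittaker.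

Section Contours.
Variable R : realType.

Definition Cderive (g : R -> R[i]) (t : R) : R[i] :=
  derive1 (fun t => complex.Re (g t)) t +i* derive1 (fun t => complex.Im (g t)) t.

Definition C1_curve (g : R -> R[i]) : Prop :=
  [/\ forall t, derivable (fun t => complex.Re (g t)) t 1,
      forall t, derivable (fun t => complex.Im (g t)) t 1,
      continuous (derive1 (fun t => complex.Re (g t)))
    & continuous (derive1 (fun t => complex.Im (g t)))].

(** Curves are parametrized by [0, 1].  Each arc extends to a C^1 map on the
    whole line, i.e. has one-sided derivatives at its ends. *)
Definition piecewise_C1 (g : R -> R[i]) : Prop :=
  exists2 ts : seq R, itv_partition 0 1 ts &
  forall i, (i < size ts)%N ->
    exists2 f, C1_curve f & {in `[nth 0 (0 :: ts) i, nth 0 ts i], g =1 f}.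

Definition Cintegral (f : R -> R[i]) : R[i] :=
  (\int[lebesgue_measure]_(t in `[0, 1]) complex.Re (f t))%R +i*
  (\int[lebesgue_measure]_(t in `[0, 1]) complex.Im (f t))%R.

(** [Cderive g] is arbitrary at the finitely many corners, which do not
    contribute to the integral. *)
Definition contour_int (g : R -> R[i]) (f : R[i] -> R[i]) : R[i] :=
  Cintegral (fun t => f (g t) * Cderive g t).

Definition two_pi_i : R[i] := 2 * (pi : R)%:C * 'i%C.

Definition curve_image (g : R -> R[i]) : set R[i] := g @` `[0, 1].

Definition compl_component (g : R -> R[i]) (z : R[i]) : set R[i]^o :=
  connected_component (~` curve_image g : set R[i]^o) z.

Definition inside (g : R -> R[i]) (z : R[i]) : Prop :=
  ~ curve_image g z /\ bounded_set (compl_component g z).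

Definition outside (g : R -> R[i]) (z : R[i]) : Prop :=
  ~ curve_image g z /\ ~ bounded_set (compl_component g z).

Definition winding (g : R -> R[i]) (z : R[i]) : R[i] :=
  two_pi_i^-1 * contour_int g (fun w => (w - z)^-1).

(** Positively oriented closed contour: piecewise C^1 Jordan curve with winding
    number 1 about the points of its interior. *)
Definition pos_closed_contour (g : R -> R[i]) : Prop :=
  [/\ piecewise_C1 g, g 0 = g 1, {in `[0, 1[ &, injective g}
    & forall z, inside g z -> winding g z = 1].

(** Iterated integral along [g] against du / (2 pi i u) in each variable; the
    first entry of the tuple is the outermost variable. *)
Fixpoint iter_contour_int (g : R -> R[i]) (n : nat) :
    (n.-tuple R[i] -> R[i]) -> R[i] :=
  match n return (n.-tuple R[i] -> R[i]) -> R[i] with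
  | 0%N => fun f => f [tuple]
  | n'.+1 => fun f =>
      contour_int g (fun u => (two_pi_i * u)^-1 *
        iter_contour_int g (fun us : n'.-tuple R[i] => f [tuple of u :: us]))
  end.

End Contours.

(* Main.v *)
Require Import Defs.
From HB Require Import structures.
From mathcomp Require Import all_boot all_order all_algebra.
From mathcomp Require Import all_classical all_reals all_analysis.
From mathcomp Require Import measurable_realfun complex.
From mathcomp Require Import ring lra.

Set Implicit Arguments.
Unset Strict Implicit.
Unset Printing Implicit Defensive.

Import Order.TTheory GRing.Theory Num.Theory.
Import numFieldNormedType.Exports.
Import ComplexField.Normc.

Local Open Scope classical_set_scope.
Local Open Scope complex_scope.
Local Open Scope ring_scope.

(** Write I_m(lambda) for the right-hand side. Multiplying the integrand by
    prod_i (1 + u_i x) / (1 - s u_i) adds a variable x; since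
    (1 + u x) / (1 - s u) is a combination of 1 and (u - s) / (1 - s u), this
    expands I_(m+1)(lambda) into integrals in which some exponents lambda'_i are
    lowered by one. All contours being equal, two adjacent integrations may be
    exchanged, and the factor (u_i - u_j) / (u_i - q u_j) turns this into the
    relation r p = q p r between p = 1 / (1 - s u) and r = u / (1 - s u).
    Normal ordering in this quantum plane (a q-Chu-Vandermonde sum) restores
    the weak decrease of the exponents, and the coefficients are exactly the row
    weights of the path model; an exponent lowered to 0 integrates to 1 by the
    residue at the origin. So both sides satisfy the same branching rule in m.
    For m = 0 the outermost integrand has all its poles inside the contour and
    is O(u^-2) at infinity, so I_0(lambda) = 0 unless lambda is empty. *)

(** * A word identity for the quantum plane *)

(** The contour is an arbitrary piecewise C^1 Jordan curve, and neither a deformation of it nor a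
    general Cauchy theorem is used. Only rational integrands occur: all powers of u - z except the
    power -1 have primitives along the curve, partial fractions reduce the rest to simple poles, and
    the integral of 1 / (u - z) is a locally constant function of z, equal to 2 pi i inside and 0
    outside. The kernel has poles at the points u / q with u on the contour, which must also be
    shown to lie outside. A relation between adjacent integrations is needed underneath the outer
    ones, so each is proved for all weights H, where H collects the kernels with the variables
    already fixed. Exchanging integrations rests on Fubini for bounded measurable functions: curve
    and velocity are extended to the whole line, and compactness keeps |u| and |u - q v| away from
    0. With p and r suitably scaled, the factors 1 - s u, u - s and 1 + x u become three linear
    forms A, B and Z in p and r, and a branching coefficient is the coefficient of A^(k-l) B^l in
    Z^k. *)

Section QBinomial.
Variables (K : fieldType) (q : K).

Definition qpochhammer (a : K) n := \prod_(i < n) (1 - a * q ^+ i).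

(** Gaussian binomial coefficient by the q-Pascal rule. The recursion, unlike the quotient of
    Pochhammer symbols, makes sense for every q. *)
Fixpoint qbinom n k : K :=
  match n, k with
  | _, 0 => 1
  | 0, _.+1 => 0
  | n'.+1, k'.+1 => qbinom n' k' + q ^+ k * qbinom n' k
  end.

Lemma qbinom0 n : qbinom n 0 = 1.
Proof. by case: n. Qed.

Lemma qbinomS n k :
  qbinom n.+1 k.+1 = qbinom n k + q ^+ k.+1 * qbinom n k.+1.
Proof. by []. Qed.

Lemma qbinom_small n k : (n < k)%N -> qbinom n k = 0.
Proof.
elim: n k => [|n IH] [|k] //= lenk.
by rewrite !IH ?mulr0 ?addr0 // ltnW.
Qed.

Lemma qbinomnn n : qbinom n n = 1.
Proof. by elim: n => [|n IH] //=; rewrite IH qbinom_small // mulr0 addr0. Qed.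

Lemma qpochhammerSr a n :
  qpochhammer a n.+1 = qpochhammer a n * (1 - a * q ^+ n).
Proof. by rewrite /qpochhammer big_ord_recr. Qed.

Lemma qpochhammerSl a n :
  qpochhammer a n.+1 = (1 - a) * qpochhammer (a * q) n.
Proof.
rewrite /qpochhammer big_ord_recl expr0 mulr1; congr (_ * _).
by apply: eq_bigr => i _; rewrite exprS mulrA.
Qed.

Lemma qpochhammer0 a : qpochhammer a 0 = 1.
Proof. by rewrite /qpochhammer big_ord0. Qed.

Lemma qpochhammerD a m n :
  qpochhammer a (m + n) = qpochhammer a m * qpochhammer (a * q ^+ m) n.
Proof.
elim: n => [|n IH]; first by rewrite addn0 qpochhammer0 mulr1.
by rewrite addnS !qpochhammerSr IH exprD !mulrA.
Qed.

Lemma qbinom_qpochhammer n k : (k <= n)%N ->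
  qbinom n k * qpochhammer q k * qpochhammer q (n - k) = qpochhammer q n.
Proof.
elim: n k => [|n IH] [|k] // lekn.
- by rewrite !qpochhammer0 !mulr1.
- by rewrite qbinom0 qpochhammer0 !mul1r subn0.
rewrite qbinomS subSS; move: lekn; rewrite ltnS leq_eqVlt => /orP[/eqP->|ltkn].
  by rewrite qbinomnn qbinom_small // mulr0 addr0 mul1r subnn qpochhammer0 mulr1.
have e1 := IH k (ltnW ltkn); have e2 := IH k.+1 ltkn.
have nk : (n - k)%N = (n - k.+1).+1 by rewrite subnSK.
have eq1 : q ^+ n.+1 = q ^+ k.+1 * q ^+ (n - k)%N by rewrite -exprD addSn subnKC // ltnW.
rewrite mulrDl mulrDl [qpochhammer q n.+1]qpochhammerSr -exprS eq1.
(* The two summands match the two terms of the q-Pascal rule. *)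
have -> : 1 - q ^+ k.+1 * q ^+ (n - k) =
  (1 - q ^+ k.+1) + q ^+ k.+1 * (1 - q ^+ (n - k)) by ring.
rewrite mulrDr -{1}e1 -e2 [qpochhammer q k.+1]qpochhammerSr -!exprS nk.
rewrite !qpochhammerSr -!exprS; ring.
Qed.

(** The q-Pascal rule in summed form: the induction step of every q-binomial expansion below. *)
Lemma sum_qbinomS (f : nat -> K) n :
  \sum_(j < n.+2) qbinom n.+1 j * f j =
  \sum_(j < n.+1) qbinom n j * (q ^+ j * f j + f j.+1).
Proof.
rewrite big_ord_recl qbinom0 mul1r.
transitivity (f 0%N + \sum_(i < n.+1)
    (qbinom n i * f i.+1 + q ^+ i.+1 * qbinom n i.+1 * f i.+1)).
  congr (_ + _); apply: eq_bigr => i _.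
  by rewrite lift0 qbinomS mulrDl.
rewrite big_split /=.
under [RHS]eq_bigr do rewrite mulrDr.
rewrite [RHS]big_split /= addrCA addrC; congr (_ + _).
rewrite [RHS]big_ord_recl qbinom0 !mul1r; congr (_ + _).
rewrite big_ord_recr /= qbinom_small // mulr0 mul0r addr0.
by apply: eq_bigr => i _; rewrite -[bump 0 i]/(i.+1) mulrCA mulrA.
Qed.

Lemma sum_geq_shift (f : nat -> K) l k : (l <= k)%N ->
  \sum_(j < k.+1 | (l <= j)%N) f j = \sum_(i < (k - l).+1) f (i + l)%N.
Proof.
move=> lelk; rewrite -(big_geq_mkord l k.+1 xpredT f) -[X in \big[_/_]_(X <= _ < _) _]add0n.
by rewrite big_addn subSn // big_mkord.
Qed.

(** The homogeneous form a^n (-b/a; q)_n of a Pochhammer symbol, valid also for a = 0. *)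
Definition qshift_prod (a b : K) n := \prod_(t < n) (a + b * q ^+ t).

Lemma qshift_prodSr a b n :
  qshift_prod a b n.+1 = qshift_prod a b n * (a + b * q ^+ n).
Proof. by rewrite /qshift_prod big_ord_recr. Qed.

Lemma qshift_prod_scale a b c n :
  qshift_prod (c * a) (c * b) n = c ^+ n * qshift_prod a b n.
Proof.
elim: n => [|n IH]; first by rewrite /qshift_prod !big_ord0 mulr1.
by rewrite !qshift_prodSr IH exprS; ring.
Qed.

Lemma qshift_prodD a b m n :
  qshift_prod a b (m + n) = qshift_prod a b m * qshift_prod a (b * q ^+ m) n.
Proof.
elim: n => [|n IH]; first by rewrite addn0 /qshift_prod big_ord0 mulr1.
by rewrite addnS !qshift_prodSr IH exprD !mulrA.
Qed.

(* A form of the q-Chu-Vandermonde identity: peel off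
   [1 + a = (1 - b q^i) + (a + b q^i)] and rescale [a] and [b] by [q]. *)
Lemma q_vandermonde a b n :
  qpochhammer (- a) n =
  \sum_(i < n.+1) qbinom n i *
    (q ^+ 'C(i, 2) * qshift_prod a b i * qpochhammer (b * q ^+ i) (n - i)).
Proof.
elim: n a b => [|n IH] a b.
  by rewrite big_ord_recl big_ord0 /= /qshift_prod !big_ord0 !qpochhammer0 expr0; ring.
rewrite (sum_qbinomS (fun i => q ^+ 'C(i, 2) * qshift_prod a b i *
  qpochhammer (b * q ^+ i) (n.+1 - i))) qpochhammerSl mulNr (IH (a * q) (b * q)) mulr_sumr.
apply: eq_bigr => i _.
have lein : (i <= n)%N by rewrite -ltnS.
rewrite subSS subSn // qpochhammerSl qshift_prodSr !exprS binS bin1 exprD.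
rewrite [a * q]mulrC [b * q]mulrC qshift_prod_scale.
rewrite -[q * b * _]mulrA -[b * q ^+ i * q]mulrA -exprSr exprS.
rewrite -[b * (q * q ^+ i)]mulrCA [q * (b * _)]mulrCA; ring.
Qed.

End QBinomial.

(** * Normal ordering of powers of linear forms in two q-commuting letters *)

Section BlockIdentity.
Variables (K : fieldType) (q s x : K).
(** A pair [(a, b)] encodes the letter a p + b r. [W] is any functional on words that is linear in
    each letter and compatible with r p = q p r; the contour integrals will be one. *)
Variable W : seq (K * K) -> K.

Hypothesis Wlin : forall w1 w2 c (a b : K * K),
  W (w1 ++ (c * a.1 + b.1, c * a.2 + b.2) :: w2) =
  c * W (w1 ++ a :: w2) + W (w1 ++ b :: w2).
Hypothesis Wexch : forall w1 w2,
  W (w1 ++ (0, 1) :: (1, 0) :: w2) = q * W (w1 ++ (1, 0) :: (0, 1) :: w2).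

(** With r = u p, the letters [A], [B], [Z] are (1 - s u) p, (u - s) p and (1 + x u) p: a variable
    whose exponent is kept, one whose exponent is lowered, and one before the expansion. *)
Let P : K * K := (1, 0).
Let Rr : K * K := (0, 1).
Let A : K * K := (1, - s).
Let B : K * K := (- s, 1).
Let Z : K * K := (1, x).

Lemma WA w1 w2 : W (w1 ++ A :: w2) = W (w1 ++ P :: w2) - s * W (w1 ++ Rr :: w2).
Proof.
have := Wlin w1 w2 (- s) Rr P; rewrite /= !mulr0 mulr1 add0r addr0 -/A => ->.
by rewrite mulNr addrC.
Qed.

Lemma WB w1 w2 : W (w1 ++ B :: w2) = W (w1 ++ Rr :: w2) - s * W (w1 ++ P :: w2).
Proof.
have := Wlin w1 w2 (- s) P Rr; rewrite /= !mulr0 mulr1 add0r addr0 -/B => ->.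
by rewrite mulNr addrC.
Qed.

Lemma WZ w1 w2 : W (w1 ++ Z :: w2) = W (w1 ++ P :: w2) + x * W (w1 ++ Rr :: w2).
Proof.
have := Wlin w1 w2 x Rr P; rewrite /= !mulr0 mulr1 add0r addr0 -/Z => ->.
by rewrite addrC.
Qed.

Lemma W_rP j w1 w2 :
  W (w1 ++ nseq j Rr ++ P :: w2) = q ^+ j * W (w1 ++ P :: nseq j Rr ++ w2).
Proof.
elim: j w1 w2 => [|j IH] w1 w2; first by rewrite mul1r.
rewrite -cat1s catA -catA /=.
have := IH (w1 ++ [:: Rr]) w2; rewrite -!catA /= => ->.
by rewrite Wexch mulrA -exprSr.
Qed.

Lemma nseq_rcat j (w : seq (K * K)) : nseq j Rr ++ Rr :: w = nseq j.+1 Rr ++ w.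
Proof. by elim: j => //= j ->. Qed.

(** Moving A to the left across r^j scales only its p part by q^j; the mismatch of the r part is the
    extra power r^(j+1). *)
Lemma W_rA j w1 w2 :
  W (w1 ++ nseq j Rr ++ A :: w2) =
  q ^+ j * W (w1 ++ A :: nseq j Rr ++ w2)
  - s * (1 - q ^+ j) * W (w1 ++ nseq j.+1 Rr ++ w2).
Proof.
rewrite catA WA -!catA W_rP nseq_rcat WA; ring.
Qed.

(** Since Z = A + (x + s) r, [W_rA] gives r^j Z = q^j A r^j + (x + s q^j) r^(j+1). This is the
    source of the product of the x + s q^t. *)
Lemma W_Zpow k w1 w2 :
  W (w1 ++ nseq k Z ++ w2) =
  \sum_(j < k.+1) qbinom q k j * (qshift_prod q x s j *
     W (w1 ++ nseq (k - j) A ++ nseq j Rr ++ w2)).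
Proof.
elim: k w2 => [|k IH] w2.
  by rewrite big_ord_recl big_ord0 /= /qshift_prod big_ord0 !mul1r addr0.
rewrite (sum_qbinomS _ (fun j => qshift_prod q x s j *
  W (w1 ++ nseq (k.+1 - j) A ++ nseq j Rr ++ w2))).
rewrite -[in LHS]addn1 nseqD -catA IH; apply: eq_bigr => j _.
have lejk : (j <= k)%N by rewrite -ltnS.
congr (_ * _); rewrite subSS subSn //=.
rewrite !catA WZ.
have -> u : W (((w1 ++ nseq (k - j) A) ++ nseq j Rr) ++ P :: u) =
   W (((w1 ++ nseq (k - j) A) ++ nseq j Rr) ++ A :: u) +
   s * W (((w1 ++ nseq (k - j) A) ++ nseq j Rr) ++ Rr :: u) by rewrite WA; ring.
rewrite -catA W_rA -!catA nseq_rcat qshift_prodSr.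
have -> u : A :: nseq (k - j) A ++ u = nseq (k - j) A ++ A :: u.
  by elim: (k - j)%N => //= i ->.
rewrite /=; ring.
Qed.

(** From B + s A = (1 - s^2) r, after moving A to the left across r^j: the defect in [W_rA] changes
    1 - s^2 into 1 - s^2 q^j. *)
Lemma W_rB j b w1 w2 :
  (1 - s ^+ 2 * q ^+ j) * W (w1 ++ nseq j.+1 Rr ++ nseq b B ++ w2) =
  W (w1 ++ nseq j Rr ++ nseq b.+1 B ++ w2) +
  s * q ^+ j * W (w1 ++ A :: nseq j Rr ++ nseq b B ++ w2).
Proof.
have := W_rA j w1 (nseq b B ++ w2); rewrite catA WA -catA.
have := WB (w1 ++ nseq j Rr) (nseq b B ++ w2).
rewrite -!catA nseq_rcat -[B :: _]/(nseq b.+1 B ++ w2) => -> e.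
have -> : W (w1 ++ nseq j Rr ++ P :: nseq b B ++ w2) =
 q ^+ j * W (w1 ++ A :: nseq j Rr ++ nseq b B ++ w2) -
    s * (1 - q ^+ j) * W (w1 ++ nseq j.+1 Rr ++ nseq b B ++ w2)
  + s * W (w1 ++ nseq j.+1 Rr ++ nseq b B ++ w2) by rewrite -e; ring.
ring.
Qed.

(** Iterating [W_rB] eliminates the letter r in favour of ordered words in A and B. The denominators
    (s^2; q)_k of the vertex weights originate here. *)
Lemma W_rpow j b w1 w2 :
  qpochhammer q (s ^+ 2) j * W (w1 ++ nseq j Rr ++ nseq b B ++ w2) =
  \sum_(i < j.+1) qbinom q j i * (s ^+ (j - i) * q ^+ 'C(j - i, 2) *
     W (w1 ++ nseq (j - i) A ++ nseq (i + b) B ++ w2)).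
Proof.
elim: j b w1 => [|j IH] b w1.
  by rewrite big_ord_recl big_ord0 qpochhammer0 /= !mul1r addr0.
rewrite (sum_qbinomS _ (fun i => s ^+ (j.+1 - i) * q ^+ 'C(j.+1 - i, 2) *
  W (w1 ++ nseq (j.+1 - i) A ++ nseq (i + b) B ++ w2))).
rewrite qpochhammerSr -mulrA W_rB mulrDr mulrCA IH.
have := IH b (w1 ++ [:: A]); rewrite -!catA /= => ->.
rewrite mulr_sumr -big_split /=; apply: eq_bigr => i _.
have leij : (i <= j)%N by rewrite -ltnS.
rewrite subSS subSn // addnS -catA /= binS bin1 exprS exprD.
have {1}-> : q ^+ j = q ^+ i * q ^+ (j - i)%N by rewrite -exprD subnKC.
ring.
Qed.

(** The share of one column in a row weight, when each horizontal edge is charged to the column it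
    enters: [k] paths leave through the top, [l] enter from the left. *)
Definition block_coef k l : K :=
  qbinom q k l * qshift_prod q x s l * qpochhammer q (- s * x) (k - l)
  / qpochhammer q (s ^+ 2) k.

Lemma W_block k w1 w2 :
  (forall i, qpochhammer q q i != 0) ->
  (forall i, qpochhammer q (s ^+ 2) i != 0) ->
  W (w1 ++ nseq k Z ++ w2) =
  \sum_(l < k.+1) block_coef k l * W (w1 ++ nseq (k - l) A ++ nseq l B ++ w2).
Proof.
move=> qq0 ss0; rewrite W_Zpow.
transitivity (\sum_(j < k.+1) \sum_(l < k.+1 | (l <= j)%N)
  qbinom q k j * qbinom q j l * qshift_prod q x s j * s ^+ (j - l)
  * q ^+ 'C(j - l, 2) / qpochhammer q (s ^+ 2) j *
     W (w1 ++ nseq (k - l) A ++ nseq l B ++ w2)).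
  apply: eq_bigr => j _.
  have := W_rpow j 0 (w1 ++ nseq (k - j) A) w2.
  rewrite -!catA /= => /(canRL (mulKf (ss0 j))) ->.
  rewrite (big_ord_widen k.+1 (fun l => qbinom q j l *
    (s ^+ (j - l) * q ^+ 'C(j - l, 2) * W ((w1 ++ nseq (k - j) A) ++
      nseq (j - l) A ++ nseq (l + 0) B ++ w2)))) // !mulr_sumr /=.
  apply: eq_bigr => l lej.
  have -> : (k - l = (k - j) + (j - l))%N.
    by rewrite addnBA // subnK // -ltnS.
  rewrite addn0 nseqD -!catA; ring.
rewrite (exchange_big_dep xpredT) //=; apply: eq_bigr => l _.
have lelk : (l <= k)%N by rewrite -ltnS.
rewrite -mulr_suml; congr (_ * _).
rewrite /block_coef; apply: (mulIf (ss0 k)); rewrite divfK //.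
have -> : - s * x = - (s * x) by rewrite mulNr.
(* The free parameter is s^2 q^l: its Pochhammer factor completes (s^2; q)_(l+i) to (s^2; q)_k, and
   once s is taken out of [qshift_prod], the product of the x + s q^t is continued from l to l + i
   factors. *)
rewrite (q_vandermonde q _ (s * (s * q ^+ l))).
have -> : \sum_(j < k.+1 | (l <= j)%N)
    qbinom q k j * qbinom q j l * qshift_prod q x s j * s ^+ (j - l)
    * q ^+ 'C(j - l, 2) / qpochhammer q (s ^+ 2) j =
  \sum_(i < (k - l).+1)
    qbinom q k (i + l) * qbinom q (i + l) l * qshift_prod q x s (i + l) * s ^+ i
  * q ^+ 'C(i, 2) / qpochhammer q (s ^+ 2) (i + l).
  pose F j := qbinom q k j * qbinom q j l * qshift_prod q x s j * s ^+ (j - l)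
  * q ^+ 'C(j - l, 2) / qpochhammer q (s ^+ 2) j.
  rewrite (sum_geq_shift F lelk).
  by apply: eq_bigr => i _; rewrite /F addnK.
rewrite mulr_suml mulr_sumr; apply: eq_bigr => i _.
have leil : (i + l <= k)%N by rewrite addnC -leq_subRL // -ltnS.
have -> : qpochhammer q (s ^+ 2) k = qpochhammer q (s ^+ 2) (i + l) *
    qpochhammer q (s ^+ 2 * q ^+ (i + l)) (k - l - i).
  by rewrite -qpochhammerD -subnDA [(l + i)%N]addnC subnKC.
rewrite [LHS]mulrA divfK //.
have -> : s ^+ 2 * q ^+ (i + l) = s * (s * q ^+ l) * q ^+ i by rewrite exprD; ring.
rewrite qshift_prod_scale [(i + l)%N]addnC qshift_prodD.
(* Trinomial revision: both sides are the q-multinomial coefficient of l, i and k - l - i. *)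
have bin : qbinom q k (l + i) * qbinom q (l + i) l = qbinom q k l * qbinom q (k - l) i.
  have h1 := @qbinom_qpochhammer _ q k (l + i); have h2 := @qbinom_qpochhammer _ q (l + i) l.
  have h3 := @qbinom_qpochhammer _ q k l; have h4 := @qbinom_qpochhammer _ q (k - l) i.
  have D0 : qpochhammer q q l * qpochhammer q q i * qpochhammer q q (k - l - i) != 0.
    by rewrite !mulf_neq0.
  rewrite -subnDA in h4 D0 *.
  have leli : (l + i <= k)%N by rewrite addnC.
  have leik : (i <= k - l)%N by rewrite -ltnS.
  apply: (mulIf D0); transitivity (qpochhammer q q k).
    by rewrite -(h1 leli) -(h2 (leq_addr _ _)) addKn; ring.
  by rewrite -(h3 lelk) -(h4 leik); ring.
rewrite bin; ring.
Qed.

End BlockIdentity.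

(** * Integrals of bounded measurable functions over [0, 1] *)

Section UnitIntervalIntegral.
Context {R : realType}.
Local Notation mu := (@lebesgue_measure R).
Local Notation I01 := (`[0%R, 1%R]%classic : set R).

Lemma measure01 : mu I01 = 1%:E.
Proof.
by rewrite (lebesgue_measure_itv `[0%R, 1%R]) /= lte_fin ltr01 -EFinB subr0.
Qed.

Lemma bounded_integrable01 (h : R -> R) (M : R) :
  measurable_fun setT h -> (forall t, `|h t| <= M) ->
  mu.-integrable I01 (EFin \o h).
Proof.
move=> mh hM; apply: measurable_bounded_integrable => //.
- by rewrite /= measure01 ltry.
- exact: measurable_funS mh.
- exists M; split; first exact: num_real.
  by move=> y My t _ /=; rewrite (le_trans (hM t)) // ltW.
Qed.

Lemma Rintegral01_cst (c : R) : \int[mu]_(t in I01) c = c.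
Proof.
by rewrite Rintegral_cst //= measure01 mulr1.
Qed.

Lemma le_norm_Rintegral01 (h : R -> R) (M : R) :
  measurable_fun setT h -> (forall t, `|h t| <= M) ->
  `|\int[mu]_(t in I01) h t| <= M.
Proof.
move=> mh hM; have ih := bounded_integrable01 mh hM.
rewrite (le_trans (le_normr_Rintegral _ ih)) // -[leRHS]Rintegral01_cst.
apply: le_Rintegral => //.
- exact: integrable_norm.
- by apply: (@bounded_integrable01 (cst M) `|M|) => //; exact: measurable_cst.
Qed.

(** Adding the bound [M] makes the integrand nonnegative, so that Tonelli applies, and the indicator
    turns integrals over [[0, 1]] into integrals over the line. As [[0, 1]] has measure 1, the shift
    adds exactly [M]. *)
Let shifted d (X : measurableType d) (f : X * R -> R) (M : R) (p : X * R) : \bar R :=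
  ((f p + M) * \1_I01 p.2)%:E.

Let shifted_ge0 d (X : measurableType d) (f : X * R -> R) (M : R) :
  (forall p, `|f p| <= M) -> forall p, (0 <= shifted f M p)%E.
Proof.
move=> fM p; rewrite lee_fin mulr_ge0 // -lerBlDr sub0r.
by have := fM p; rewrite ler_norml => /andP[].
Qed.

Let measurable_shifted d (X : measurableType d) (f : X * R -> R) (M : R) :
  measurable_fun setT f -> measurable_fun [set: X * R] (shifted f M).
Proof.
move=> mf; apply/measurable_EFinP; apply: measurable_funM.
  by apply: measurable_funD => //; exact: measurable_cst.
by apply: measurableT_comp => //; exact: measurable_indic.
Qed.

Let integral_shifted d (X : measurableType d) (f : X * R -> R) (M : R) x :
  measurable_fun setT f -> (forall p, `|f p| <= M) ->
  (\int[mu]_t shifted f M (x, t))%E =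
  (\int[mu]_(t in I01) f (x, t) + M)%:E.
Proof.
move=> mf fM.
have mfx : measurable_fun setT (fun t => f (x, t)).
  by apply: measurableT_comp => //; exact: pair1_measurable.
have ifx : mu.-integrable I01 (EFin \o (fun t => f (x, t))).
  by apply: bounded_integrable01 => // t; exact: fM.
have iM : mu.-integrable I01 (EFin \o cst M).
  by apply: (@bounded_integrable01 _ `|M|) => //; exact: measurable_cst.
rewrite -[M in RHS]Rintegral01_cst -RintegralD //= /Rintegral fineK; last first.
  apply: integrable_fin_num => //.
  exact: (integrableD _ ifx iM).
rewrite [RHS]integral_mkcond; apply: eq_integral => t _.
by rewrite /shifted /patch indicE; case: ifPn; rewrite ?mulr1 ?mulr0.
Qed.

Lemma measurable_Rintegral01 d (X : measurableType d) (f : X * R -> R) (M : R) :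
  measurable_fun setT f -> (forall p, `|f p| <= M) ->
  measurable_fun setT (fun x => \int[mu]_(t in I01) f (x, t)).
Proof.
move=> mf fM.
have -> : (fun x => \int[mu]_(t in I01) f (x, t)) =
    (fun x => fine (fubini_F mu (shifted f M) x) - M).
  by apply/funext => x; rewrite /fubini_F integral_shifted //= addrK.
apply: measurable_funB; last exact: measurable_cst.
apply: measurableT_comp => //.
by apply: measurable_fun_fubini_tonelli_F => //;
  [exact: measurable_shifted | exact: shifted_ge0].
Qed.

Lemma Rintegral01_swap (f : R * R -> R) (M : R) :
  measurable_fun setT f -> (forall p, `|f p| <= M) ->
  \int[mu]_(t in I01) \int[mu]_(u in I01) f (t, u) =
  \int[mu]_(u in I01) \int[mu]_(t in I01) f (t, u).
Proof.
move=> mf fM.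
have M0 : 0 <= M by apply: le_trans (fM (0, 0)).
pose f' (p : R * R) := f (p.2, p.1).
have mf' : measurable_fun setT f'.
  by apply: measurableT_comp => //; apply: measurable_fun_pair.
have f'M p : `|f' p| <= M by exact: fM.
pose F (p : R * R) := ((f p + M) * \1_I01 p.1 * \1_I01 p.2)%:E.
have F0 p : (0 <= F p)%E.
  rewrite lee_fin mulr_ge0 // mulr_ge0 // -lerBlDr sub0r.
  by have := fM p; rewrite ler_norml => /andP[].
have mF : measurable_fun setT F.
  apply/measurable_EFinP; do !apply: measurable_funM.
  - by apply: measurable_funD => //; exact: measurable_cst.
  - by apply: measurableT_comp => //; exact: measurable_indic.
  - by apply: measurableT_comp => //; exact: measurable_indic.
(* One order of integration for a generic [h]. Taken at [f] and at its transpose, it yields both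
   orders with the same shift [M], which then cancels. *)
have aux (h : R * R -> R) : measurable_fun setT h -> (forall p, `|h p| <= M) ->
    (\int[mu]_t \int[mu]_u ((h (t, u) + M) * \1_I01 t * \1_I01 u)%:E)%E =
    (\int[mu]_(t in I01) \int[mu]_(u in I01) h (t, u) + M)%:E.
  move=> mh hM.
  have mint := measurable_Rintegral01 mh hM.
  have hint t : `|\int[mu]_(u in I01) h (t, u)| <= M.
    apply: le_norm_Rintegral01 => //.
    by apply: measurableT_comp => //; exact: pair1_measurable.
  rewrite -(@integral_shifted _ _
    (fun p : R * R => \int[mu]_(u in I01) h (p.2, u)) M 0) //; last first.
    exact: (measurableT_comp mint measurable_snd).
  apply: eq_integral => t _; rewrite /shifted /=.
  transitivity (\int[mu]_u ((\1_I01 t)%:E * shifted h M (t, u)))%E.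
    by apply: eq_integral => u _; rewrite /shifted -EFinM /=; congr (_%:E); ring.
  rewrite ge0_integralZl_EFin //.
  - by rewrite integral_shifted // -EFinM mulrC.
  - by move=> u _; exact: shifted_ge0.
  - by apply: measurableT_comp; [exact: measurable_shifted | exact: pair1_measurable].
have := @fubini_tonelli _ _ _ _ _ mu mu F mF F0; rewrite /fubini_F /fubini_G /F /= aux //.
have := aux f' mf' f'M; rewrite /f' /=.
under eq_integral do under eq_integral do rewrite mulrAC.
by move=> -> [] /addIr.
Qed.

End UnitIntervalIntegral.

(** * Bounded measurable complex functions and their integrals *)

Section BoundedMeasurable.
Context {R : realType}.
Local Notation mu := (@lebesgue_measure R).
Local Notation I01 := (`[0%R, 1%R]%classic : set R).

Lemma Re_mul (a b : R[i]) :
  complex.Re (a * b) = complex.Re a * complex.Re b - complex.Im a * complex.Im b.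
Proof. by case: a b => [? ?] [? ?]. Qed.

Lemma Im_mul (a b : R[i]) :
  complex.Im (a * b) = complex.Re a * complex.Im b + complex.Im a * complex.Re b.
Proof. by case: a b => [? ?] [? ?]. Qed.

Lemma Re_add (a b : R[i]) : complex.Re (a + b) = complex.Re a + complex.Re b.
Proof. by case: a b => [? ?] [? ?]. Qed.

Lemma Im_add (a b : R[i]) : complex.Im (a + b) = complex.Im a + complex.Im b.
Proof. by case: a b => [? ?] [? ?]. Qed.

Lemma Re_inv (a : R[i]) : complex.Re a^-1 = complex.Re a * (normc a ^+ 2)^-1.
Proof.
by case: a => a b; rewrite /= sqr_sqrtr // addr_ge0 // sqr_ge0.
Qed.

Lemma Im_inv (a : R[i]) : complex.Im a^-1 = - complex.Im a * (normc a ^+ 2)^-1.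
Proof.
by case: a => a b; rewrite /= sqr_sqrtr ?addr_ge0 ?sqr_ge0 // mulNr.
Qed.

Lemma normc_sqr (a : R[i]) : normc a ^+ 2 = complex.Re a ^+ 2 + complex.Im a ^+ 2.
Proof. by case: a => a b; rewrite /= sqr_sqrtr // addr_ge0 // sqr_ge0. Qed.

Lemma normc_ge0 (a : R[i]) : 0 <= normc a.
Proof. by case: a => a b; rewrite /= sqrtr_ge0. Qed.

Lemma normc_eq0 (a : R[i]) : (normc a == 0) = (a == 0).
Proof.
by apply/eqP/eqP => [/eq0_normc //|->]; rewrite normc0.
Qed.

Lemma normc_gt0 (a : R[i]) : (0 < normc a) = (a != 0).
Proof. by rewrite lt_neqAle normc_ge0 andbT eq_sym normc_eq0. Qed.

Lemma le_Re_normc (a : R[i]) : `|complex.Re a| <= normc a.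
Proof.
case: a => a b /=; rewrite -sqrtr_sqr ler_wsqrtr // lerDl sqr_ge0 //.
Qed.

Lemma le_Im_normc (a : R[i]) : `|complex.Im a| <= normc a.
Proof.
case: a => a b /=; rewrite -sqrtr_sqr ler_wsqrtr // lerDr sqr_ge0 //.
Qed.

Lemma normc_le_ReIm (a : R[i]) : normc a <= `|complex.Re a| + `|complex.Im a|.
Proof.
case: a => a b /=.
have h : 0 <= `|a| + `|b| by rewrite addr_ge0.
rewrite -[leRHS]ger0_norm // -sqrtr_sqr ler_wsqrtr //.
rewrite -[a ^+ 2]real_normK ?num_real // -[b ^+ 2]real_normK ?num_real //.
have := normr_ge0 a; have := normr_ge0 b; nra.
Qed.

Lemma normcX (a : R[i]) n : normc (a ^+ n) = normc a ^+ n.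
Proof. by elim: n => [|n IH]; rewrite ?normc1 // !exprS normcM IH. Qed.

Lemma normcB_ge (a b : R[i]) : normc a - normc b <= normc (a - b).
Proof. by rewrite lerBlDr -{1}[a](subrK b); exact: le_normcD. Qed.

Lemma complexP (a b : R[i]) : complex.Re a = complex.Re b ->
  complex.Im a = complex.Im b -> a = b.
Proof. by case: a b => [? ?] [? ?] /= -> ->. Qed.

(** A class closed under products and under integration of a parameter, in which integrability over
    [[0, 1]] and Fubini hold without further conditions. *)
Definition bounded_measurable d (X : measurableType d) (f : X -> R[i]) : Prop :=
  [/\ measurable_fun setT (fun x => complex.Re (f x)),
      measurable_fun setT (fun x => complex.Im (f x))
    & exists M : R, forall x, normc (f x) <= M].

Section Closure.
Context d (X : measurableType d).
Implicit Types f h : X -> R[i].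

Lemma bounded_measurable_cst (c : R[i]) : bounded_measurable (fun _ : X => c).
Proof. by split; [exact: measurable_cst..|exists (normc c)]. Qed.

Lemma bounded_measurableD f h : bounded_measurable f -> bounded_measurable h ->
  bounded_measurable (fun x => f x + h x).
Proof.
move=> [rf jf [M fM]] [rh jh [N hN]]; split.
- by under eq_fun do rewrite Re_add; exact: measurable_funD.
- by under eq_fun do rewrite Im_add; exact: measurable_funD.
- by exists (M + N) => x; rewrite (le_trans (le_normcD _ _)) // lerD.
Qed.

Lemma bounded_measurableM f h : bounded_measurable f -> bounded_measurable h ->
  bounded_measurable (fun x => f x * h x).
Proof.
move=> [rf jf [M fM]] [rh jh [N hN]]; split.
- under eq_fun do rewrite Re_mul.
  by apply: measurable_funB; exact: measurable_funM.
- under eq_fun do rewrite Im_mul.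
  by apply: measurable_funD; exact: measurable_funM.
- by exists (M * N) => x; rewrite normcM ler_pM // normc_ge0.
Qed.

Lemma bounded_measurableZ f (c : R[i]) : bounded_measurable f ->
  bounded_measurable (fun x => c * f x).
Proof. by apply: bounded_measurableM; exact: bounded_measurable_cst. Qed.

Lemma bounded_measurableX f n : bounded_measurable f ->
  bounded_measurable (fun x => f x ^+ n).
Proof.
move=> bf; elim: n => [|n IH]; first exact: bounded_measurable_cst.
by under eq_fun do rewrite exprS; exact: bounded_measurableM.
Qed.

Lemma bounded_measurable_prod (I : Type) (r : seq I) (f : I -> X -> R[i]) :
  (forall i, bounded_measurable (f i)) ->
  bounded_measurable (fun x => \prod_(i <- r) f i x).
Proof.
move=> bf; elim: r => [|i r IH].
  by under eq_fun do rewrite big_nil; exact: bounded_measurable_cst.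
by under eq_fun do rewrite big_cons; exact: bounded_measurableM.
Qed.

Lemma bounded_measurableV f (e : R) : 0 < e -> (forall x, e <= normc (f x)) ->
  bounded_measurable f -> bounded_measurable (fun x => (f x)^-1).
Proof.
move=> e0 fe [rf jf _].
have mV : measurable_fun setT (fun x => (normc (f x) ^+ 2)^-1).
  under eq_fun do rewrite -powR_inv1 ?sqr_ge0 // normc_sqr.
  apply: (measurableT_comp (measurable_powR _)).
  by apply: measurable_funD; exact: measurable_funX.
split.
- by under eq_fun do rewrite Re_inv; exact: measurable_funM.
- under eq_fun do rewrite Im_inv.
  by apply: measurable_funM => //; exact: measurable_funN.
- exists e^-1 => x; rewrite normcV lef_pV2 ?posrE //.
  exact: lt_le_trans (fe x).
Qed.

Lemma bounded_measurable_comp d' (Y : measurableType d') f (phi : Y -> X) :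
  measurable_fun setT phi -> bounded_measurable f ->
  bounded_measurable (fun y => f (phi y)).
Proof.
move=> mphi [rf jf [M fM]]; split.
- exact: (measurableT_comp rf mphi).
- exact: (measurableT_comp jf mphi).
- by exists M.
Qed.

End Closure.

Lemma bounded_measurable_section d d' (X : measurableType d)
    (Y : measurableType d') (f : X * Y -> R[i]) x :
  bounded_measurable f -> bounded_measurable (fun y => f (x, y)).
Proof. by apply: bounded_measurable_comp; exact: pair1_measurable. Qed.

Section Cintegral.
Implicit Types f h : R -> R[i].

Lemma Re_Cintegral f :
  complex.Re (Cintegral f) = \int[mu]_(t in I01) complex.Re (f t).
Proof. by []. Qed.

Lemma Im_Cintegral f :
  complex.Im (Cintegral f) = \int[mu]_(t in I01) complex.Im (f t).
Proof. by []. Qed.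

Lemma eq_Cintegral f h : {in `[0, 1], f =1 h} -> Cintegral f = Cintegral h.
Proof.
by move=> fh; apply: complexP; rewrite /=; apply: eq_Rintegral => t /set_mem /=
  t01; rewrite fh.
Qed.

Lemma bounded_measurable_integrable f : bounded_measurable f ->
  mu.-integrable I01 (EFin \o (fun t => complex.Re (f t))) /\
  mu.-integrable I01 (EFin \o (fun t => complex.Im (f t))).
Proof.
move=> [rf jf [M fM]]; split; apply: (@bounded_integrable01 _ _ M) => // t.
- exact: le_trans (le_Re_normc _) _.
- exact: le_trans (le_Im_normc _) _.
Qed.

Lemma CintegralD f h : bounded_measurable f -> bounded_measurable h ->
  Cintegral (fun t => f t + h t) = Cintegral f + Cintegral h.
Proof.
move=> /bounded_measurable_integrable[rf jf] /bounded_measurable_integrable[rh jh].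
apply: complexP; rewrite ?Re_add ?Im_add ?Re_Cintegral ?Im_Cintegral.
- by under eq_Rintegral do rewrite Re_add; exact: RintegralD.
- by under eq_Rintegral do rewrite Im_add; exact: RintegralD.
Qed.

Lemma CintegralZ f c : bounded_measurable f ->
  Cintegral (fun t => c * f t) = c * Cintegral f.
Proof.
move=> /bounded_measurable_integrable[rf jf].
have Z (a : R) k : mu.-integrable I01 (EFin \o k) ->
    mu.-integrable I01 (EFin \o (fun t => a * k t)).
  by move=> ik; exact: (integrableZl _ a ik).
apply: complexP; rewrite ?Re_mul ?Im_mul ?Re_Cintegral ?Im_Cintegral.
- under eq_Rintegral do rewrite Re_mul.
  by rewrite RintegralB ?RintegralZl //; exact: Z.
- under eq_Rintegral do rewrite Im_mul.
  by rewrite RintegralD ?RintegralZl //; exact: Z.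
Qed.

(** The two parts are bounded separately. The lost factor is harmless: the bound serves for
    boundedness and for geometric decay only. *)
Lemma normc_Cintegral f (M : R) : bounded_measurable f ->
  (forall t, normc (f t) <= M) -> normc (Cintegral f) <= M + M.
Proof.
move=> [rf jf _] fM; apply: le_trans (normc_le_ReIm _) _.
by apply: lerD; apply: le_norm_Rintegral01 => // t;
  [exact: le_trans (le_Re_normc _) _ | exact: le_trans (le_Im_normc _) _].
Qed.

Lemma bounded_measurable_Cintegral d (X : measurableType d) (f : X * R -> R[i]) :
  bounded_measurable f ->
  bounded_measurable (fun x => Cintegral (fun t => f (x, t))).
Proof.
move=> bf; have [rf jf [M fM]] := bf; split.
- apply: (measurable_Rintegral01 (M := M)) rf _ => p.
  exact: le_trans (le_Re_normc _) _.
- apply: (measurable_Rintegral01 (M := M)) jf _ => p.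
  exact: le_trans (le_Im_normc _) _.
- exists (M + M) => x; apply: normc_Cintegral => //.
  exact: bounded_measurable_section.
Qed.

Lemma Cintegral_swap (f : R * R -> R[i]) : bounded_measurable f ->
  Cintegral (fun t => Cintegral (fun u => f (t, u))) =
  Cintegral (fun u => Cintegral (fun t => f (t, u))).
Proof.
move=> [rf jf [M fM]]; apply: complexP; rewrite /=.
- apply: (Rintegral01_swap (M := M)) rf _ => p.
  exact: le_trans (le_Re_normc _) _.
- apply: (Rintegral01_swap (M := M)) jf _ => p.
  exact: le_trans (le_Im_normc _) _.
Qed.

End Cintegral.

End BoundedMeasurable.

(** * Nested contour integrals *)

Section NestedIntegrals.
Context {R : realType}.
Variables (q : R[i]) (g G dG : R -> R[i]).

Definition kernel (u v : R[i]) : R[i] := (u - v) / (u - q * v).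

(** The weight [H] multiplies every remaining variable and accumulates its kernels with the
    variables already bound, so that an inner integral is again of the form [nested]. *)
Fixpoint nested (fs : seq (R[i] -> R[i])) (H : R[i] -> R[i]) : R[i] :=
  if fs is f :: fs' then
    contour_int g (fun u => (two_pi_i R * u)^-1 *
      (f u * H u * nested fs' (fun v => H v * kernel u v)))
  else 1.

(** [G] and [dG] stand for the curve and its velocity, extended to the whole line. The gaps [e0] and
    [e1] below keep 1 / u and 1 / (u - q v) bounded. *)
Hypothesis bG : bounded_measurable G.
Hypothesis bdG : bounded_measurable dG.
Hypothesis contourE :
  forall f, contour_int g f = Cintegral (fun t => f (G t) * dG t).
Variables e0 e1 : R.
Hypothesis e0_gt0 : 0 < e0.
Hypothesis e1_gt0 : 0 < e1.
Hypothesis G_ge : forall t, e0 <= normc (G t).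
Hypothesis GG_ge : forall t u, e1 <= normc (G t - q * G u).

Definition tame (f : R[i] -> R[i]) := bounded_measurable (fun t => f (G t)).

Fixpoint all_tame (fs : seq (R[i] -> R[i])) : Prop :=
  if fs is f :: fs' then tame f /\ all_tame fs' else True.

Lemma all_tame_cat fs fs' :
  all_tame (fs ++ fs') <-> all_tame fs /\ all_tame fs'.
Proof. by elim: fs => [|f fs IH] /=; [split=> [|[]] | rewrite IH; tauto]. Qed.

Lemma all_tame_nseq n f : tame f -> all_tame (nseq n f).
Proof. by elim: n => //= n IH bf; split=> //; exact: IH. Qed.

Definition cauchy_weight t := (two_pi_i R * G t)^-1 * dG t.

Lemma two_pi_i_neq0 : two_pi_i R != 0.
Proof.
rewrite /two_pi_i !mulf_neq0 ?pnatr_eq0 //.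
- by rewrite eq_complex /= eqxx andbT gt_eqF // pi_gt0.
- by rewrite eq_complex /= oner_eq0 andbF.
Qed.

Lemma GG_neq0 t u : G t - q * G u != 0.
Proof. by rewrite -normc_gt0 (lt_le_trans e1_gt0). Qed.

Let bcw : bounded_measurable cauchy_weight.
Proof.
apply: bounded_measurableM => //.
apply: (bounded_measurableV (e := normc (two_pi_i R) * e0)).
- by rewrite mulr_gt0 // normc_gt0 two_pi_i_neq0.
- by move=> t; rewrite [leRHS]normcM ler_wpM2l // normc_ge0.
- exact: bounded_measurableZ.
Qed.

Lemma nested_cons f fs H : nested (f :: fs) H =
  Cintegral (fun t => f (G t) * H (G t) *
    nested fs (fun v => H v * kernel (G t) v) * cauchy_weight t).
Proof.
rewrite /= contourE; congr Cintegral; apply/funext => t.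
by rewrite /cauchy_weight -!mulrA mulrC -!mulrA; congr (_ * (_ * (_ * _))); rewrite mulrC.
Qed.

Lemma bounded_measurable_kernel :
  bounded_measurable (fun p : R * R => kernel (G p.1) (G p.2)).
Proof.
have b1 : bounded_measurable (fun p : R * R => G p.1).
  by apply: bounded_measurable_comp => //; exact: measurable_fst.
have b2 : bounded_measurable (fun p : R * R => G p.2).
  by apply: bounded_measurable_comp => //; exact: measurable_snd.
have bN c (h : R * R -> R[i]) : bounded_measurable h ->
    bounded_measurable (fun p => G p.1 - c * h p).
  move=> bh; under eq_fun do rewrite -mulNr.
  by apply: bounded_measurableD => //; exact: bounded_measurableZ.
apply: bounded_measurableM.
  by have := bN 1 _ b2; under eq_fun do rewrite mul1r.
by apply: (bounded_measurableV e1_gt0) => [p|]; [exact: GG_ge | exact: bN].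
Qed.

Lemma bounded_measurable_mul_kernel d (X : measurableType d)
    (H : X -> R[i] -> R[i]) :
  bounded_measurable (fun p : X * R => H p.1 (G p.2)) ->
  bounded_measurable (fun p : (X * R) * R =>
    H p.1.1 (G p.2) * kernel (G p.1.2) (G p.2)).
Proof.
move=> bH; apply: bounded_measurableM.
- apply: (bounded_measurable_comp (phi := fun p : (X * R) * R => (p.1.1, p.2)) _ bH).
  apply: measurable_fun_pair => //.
  exact: (measurableT_comp measurable_fst measurable_fst).
- apply: (bounded_measurable_comp (phi := fun p : (X * R) * R => (p.1.2, p.2)) _
    bounded_measurable_kernel).
  apply: measurable_fun_pair => //.
  exact: (measurableT_comp measurable_snd measurable_fst).
Qed.

(** The parameter space is arbitrary because each integration adds the bound variable to the
    parameters, passing from [X] to [X * R]. *)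
Lemma bounded_measurable_nested fs : all_tame fs ->
  forall d (X : measurableType d) (H : X -> R[i] -> R[i]),
  bounded_measurable (fun p : X * R => H p.1 (G p.2)) ->
  bounded_measurable (fun x => nested fs (H x)).
Proof.
elim: fs => [|f fs IH] /= adm d X H bH; first exact: bounded_measurable_cst.
have [bf bfs] := adm.
under eq_fun do rewrite -[contour_int _ _]/(nested (f :: fs) _) nested_cons.
pose F (p : X * R) := f (G p.2) * H p.1 (G p.2) *
    nested fs (fun v => H p.1 v * kernel (G p.2) v) * cauchy_weight p.2.
apply: (@bounded_measurable_Cintegral _ _ _ F).
apply: bounded_measurableM; last first.
  by apply: bounded_measurable_comp => //; exact: measurable_snd.
apply: bounded_measurableM.
  apply: bounded_measurableM => //.
  by apply: (bounded_measurable_comp _ bf); exact: measurable_snd.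
apply: (IH bfs _ _ (fun (p : X * R) v => H p.1 v * kernel (G p.2) v)).
exact: bounded_measurable_mul_kernel.
Qed.

Lemma tame_kernel H t :
  tame H -> tame (fun v => H v * kernel (G t) v).
Proof.
move=> bH; apply: bounded_measurableM => //.
exact: (bounded_measurable_section t bounded_measurable_kernel).
Qed.

Lemma tame_kernel_l t : tame (fun v => kernel v (G t)).
Proof.
apply: (bounded_measurable_comp (phi := fun u : R => (u, t)) _
  bounded_measurable_kernel).
exact: pair2_measurable.
Qed.

Let bm_integrand f fs H : tame f -> all_tame fs ->
  tame H ->
  bounded_measurable (fun t => f (G t) * H (G t) *
    nested fs (fun v => H v * kernel (G t) v) * cauchy_weight t).
Proof.
move=> bf bfs bH; apply: bounded_measurableM => //; apply: bounded_measurableM.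
  exact: bounded_measurableM.
apply: (@bounded_measurable_nested _ bfs _ _ (fun t v => H v * kernel (G t) v)).
apply: bounded_measurableM; last exact: bounded_measurable_kernel.
by apply: bounded_measurable_comp bH; exact: measurable_snd.
Qed.

(** Relations pass under outer integrals. They are required for all tame weights since each variable
    of the prefix multiplies the weight by a kernel. The list [cs] covers both the two-term
    linearity and the one-term exchange. *)
Lemma nested_prefix pre a (cs : seq (R[i] * seq (R[i] -> R[i]))) H :
  all_tame pre -> (forall c, List.In c cs -> all_tame c.2) ->
  (forall H, tame H ->
     nested a H = \sum_(c <- cs) c.1 * nested c.2 H) ->
  tame H ->
  nested (pre ++ a) H = \sum_(c <- cs) c.1 * nested (pre ++ c.2) H.
Proof.
move=> bpre bcs e; elim: pre bpre H => [|f pre IH] /= bpre H bH; first exact: e.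
have [bf {}bpre] := bpre.
rewrite -[contour_int _ _]/(nested (f :: _) H) nested_cons.
under eq_fun do rewrite (IH bpre _ (tame_kernel _ bH)).
under eq_bigr do rewrite -[contour_int _ _]/(nested (f :: _) H) nested_cons.
elim: cs bcs {e IH} => [|c cs IH] bcs.
  rewrite big_nil; under eq_fun do rewrite big_nil mulr0 mul0r.
  by apply: complexP; rewrite /= Rintegral01_cst.
have bint c' : List.In c' (c :: cs) -> bounded_measurable (fun t =>
    f (G t) * H (G t) * nested (pre ++ c'.2) (fun v => H v * kernel (G t) v)
    * cauchy_weight t).
  by move=> /bcs bc; apply: bm_integrand => //; apply/all_tame_cat.
rewrite big_cons -CintegralZ; last by apply: bint; left.
rewrite -IH; last by move=> c' c'cs; apply: bcs; right.
rewrite -CintegralD.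
- by congr Cintegral; apply/funext => t; rewrite big_cons; ring.
- by apply: bounded_measurableZ; apply: bint; left.
elim: cs {IH} bint {bcs} => [|c' cs IH] bint.
  under eq_fun do rewrite big_nil mulr0 mul0r.
  exact: bounded_measurable_cst.
under eq_fun do rewrite big_cons mulrDr mulrDl.
apply: bounded_measurableD; last first.
  by apply: IH => c'' [<-|c''cs]; apply: bint; [left|right; right].
rewrite (_ : (fun _ => _) = fun t => c'.1 * (f (G t) * H (G t) *
    nested (pre ++ c'.2) (fun v => H v * kernel (G t) v)
    * cauchy_weight t)); last first.
  by apply/funext => t; ring.
by apply: bounded_measurableZ; apply: bint; right; left.
Qed.

Lemma nested_linear f1 f2 c w H : tame f1 -> tame f2 ->
  all_tame w -> tame H ->
  nested ((fun u => c * f1 u + f2 u) :: w) H =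
  c * nested (f1 :: w) H + nested (f2 :: w) H.
Proof.
move=> b1 b2 bw bH; rewrite !nested_cons.
rewrite -CintegralZ; last exact: bm_integrand.
rewrite -CintegralD; last 2 first.
- by apply: bounded_measurableZ; exact: bm_integrand.
- exact: bm_integrand.
by congr Cintegral; apply/funext => t; ring.
Qed.

Let nested2 f1 f2 w H : tame f2 -> all_tame w ->
    tame H ->
  nested (f1 :: f2 :: w) H =
  Cintegral (fun t => Cintegral (fun u =>
    f1 (G t) * f2 (G u) * kernel (G t) (G u) * (H (G t) * H (G u) *
    nested w (fun v => H v * kernel (G t) v * kernel (G u) v)
    * cauchy_weight t * cauchy_weight u))).
Proof.
move=> b2 bw bH; rewrite nested_cons; congr Cintegral; apply/funext => t.
rewrite nested_cons mulrAC -CintegralZ.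
  by congr Cintegral; apply/funext => u; ring.
by apply: bm_integrand => //; exact: tame_kernel.
Qed.

Let bm_rest w H : all_tame w -> tame H ->
  bounded_measurable (fun p : R * R => H (G p.1) * H (G p.2) *
    nested w (fun v => H v * kernel (G p.1) v * kernel (G p.2) v)
    * cauchy_weight p.1 * cauchy_weight p.2).
Proof.
move=> bw bH.
have m1 := @measurable_fst _ _ R R; have m2 := @measurable_snd _ _ R R.
apply: bounded_measurableM; last exact: bounded_measurable_comp bcw.
apply: bounded_measurableM; last exact: bounded_measurable_comp bcw.
apply: bounded_measurableM.
  by apply: bounded_measurableM; exact: bounded_measurable_comp bH.
apply: (@bounded_measurable_nested _ bw _ _
  (fun (p : R * R) v => H v * kernel (G p.1) v * kernel (G p.2) v)).
apply: (@bounded_measurable_mul_kernel _ _ (fun t v => H v * kernel (G t) v)).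
apply: bounded_measurableM; last exact: bounded_measurable_kernel.
exact: bounded_measurable_comp bH.
Qed.

(* After multiplication by [u - q v] the kernel becomes antisymmetric, while
   the rest of the integrand is symmetric in [u] and [v]. *)
Lemma nested_exchange p w H : tame p -> all_tame w ->
    tame H ->
  nested ((fun u => u * p u) :: p :: w) H =
  q * nested (p :: (fun u => u * p u) :: w) H.
Proof.
move=> bp bw bH.
have bup : tame (fun u => u * p u) by exact: bounded_measurableM.
have m1 := @measurable_fst _ _ R R; have m2 := @measurable_snd _ _ R R.
pose D (x : R * R) := (G x.1 - G x.2) * p (G x.1) * p (G x.2) *
  (H (G x.1) * H (G x.2) *
    nested w (fun v => H v * kernel (G x.1) v * kernel (G x.2) v)
    * cauchy_weight x.1 * cauchy_weight x.2).
have bD : bounded_measurable D.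
  apply: bounded_measurableM; last exact: bm_rest.
  apply: bounded_measurableM; last exact: bounded_measurable_comp bp.
  apply: bounded_measurableM; last exact: bounded_measurable_comp bp.
  apply: bounded_measurableD; first exact: bounded_measurable_comp bG.
  under eq_fun do rewrite -mulN1r.
  by apply: bounded_measurableZ; exact: bounded_measurable_comp bG.
have D0 : Cintegral (fun t => Cintegral (fun u => D (t, u))) = 0.
  have : Cintegral (fun t => Cintegral (fun u => D (t, u))) =
      - Cintegral (fun t => Cintegral (fun u => D (t, u))).
    rewrite {1}Cintegral_swap // -mulN1r -CintegralZ; last first.
      exact: bounded_measurable_Cintegral.
    congr Cintegral; apply/funext => u; rewrite -CintegralZ; last first.
      exact: bounded_measurable_section.
    congr Cintegral; apply/funext => t; rewrite /D /=.
    have -> : (fun v => H v * kernel (G u) v * kernel (G t) v) =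
        (fun v => H v * kernel (G t) v * kernel (G u) v).
      by apply/funext => v; rewrite mulrAC.
    by ring.
  by move/eqP; rewrite -addr_eq0 -mulr2n mulrn_eq0 => /eqP.
apply/eqP; rewrite -subr_eq0 !nested2 //.
pose E f1 f2 (x : R * R) := f1 (G x.1) * f2 (G x.2) * kernel (G x.1) (G x.2) *
  (H (G x.1) * H (G x.2) *
    nested w (fun v => H v * kernel (G x.1) v * kernel (G x.2) v)
    * cauchy_weight x.1 * cauchy_weight x.2).
have bE f1 f2 : tame f1 -> tame f2 -> bounded_measurable (E f1 f2).
  move=> b1 b2; apply: bounded_measurableM; last exact: bm_rest.
  apply: bounded_measurableM; last exact: bounded_measurable_kernel.
  apply: bounded_measurableM; first exact: bounded_measurable_comp b1.
  exact: bounded_measurable_comp b2.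
pose up u := u * p u.
have bI f1 f2 (b1 : tame f1) (b2 : tame f2) :
    bounded_measurable (fun t => Cintegral (fun u => E f1 f2 (t, u))).
  exact/bounded_measurable_Cintegral/bE.
rewrite -[X in _ - _ * X]/(Cintegral (fun t => Cintegral (fun u => E p up (t, u)))).
rewrite -[X in X - _]/(Cintegral (fun t => Cintegral (fun u => E up p (t, u)))).
rewrite -mulNr -CintegralZ; last exact: bI.
rewrite -CintegralD; last 2 first.
- exact: bI.
- by apply: bounded_measurableZ; exact: bI.
rewrite -[X in _ == X]D0; apply/eqP; congr Cintegral; apply/funext => t.
rewrite -CintegralZ; last by apply: bounded_measurable_section; exact: bE.
rewrite -CintegralD; last 2 first.
- by apply: bounded_measurable_section; exact: bE.
- by apply: bounded_measurableZ; apply: bounded_measurable_section; exact: bE.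
congr Cintegral; apply/funext => u; rewrite /E /D /= /up.
move: (cauchy_weight t) (cauchy_weight u) (nested _ _) => a b c; rewrite /kernel.
by field; exact: GG_neq0.
Qed.

(** By Fubini the outermost variable is integrated first, all others being fixed. Each variable it
    is moved past leaves a kernel, which is absorbed into [phi]; hence the assumption on arbitrary
    products of kernels. *)
Lemma nested_front_vanish fs phi H : all_tame fs -> tame phi ->
  tame H ->
  (forall vs : seq R, Cintegral (fun t =>
     phi (G t) * (\prod_(v <- vs) kernel (G t) (G v)) * cauchy_weight t) = 0) ->
  Cintegral (fun t => phi (G t) *
    nested fs (fun v => H v * kernel (G t) v) * cauchy_weight t) = 0.
Proof.
elim: fs phi H => [|f fs IH] phi H /= bfs bphi bH phi0.
  by have := phi0 [::]; under eq_fun do rewrite big_nil.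
have [bf {}bfs] := bfs.
have m1 := @measurable_fst _ _ R R; have m2 := @measurable_snd _ _ R R.
pose E (x : R * R) := f (G x.2) * H (G x.2) * cauchy_weight x.2 *
  (phi (G x.1) * kernel (G x.1) (G x.2) *
   nested fs (fun v => H v * kernel (G x.1) v * kernel (G x.2) v) * cauchy_weight x.1).
have bnest : bounded_measurable (fun p : R * R =>
    nested fs (fun v => H v * kernel (G p.1) v * kernel (G p.2) v)).
  apply: (@bounded_measurable_nested _ bfs _ _
    (fun (p : R * R) v => H v * kernel (G p.1) v * kernel (G p.2) v)).
  apply: (@bounded_measurable_mul_kernel _ _ (fun t v => H v * kernel (G t) v)).
  apply: bounded_measurableM; last exact: bounded_measurable_kernel.
  exact: bounded_measurable_comp bH.
have bE : bounded_measurable E.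
  apply: bounded_measurableM.
    apply: bounded_measurableM; last exact: bounded_measurable_comp bcw.
    apply: bounded_measurableM; first exact: bounded_measurable_comp bf.
    exact: bounded_measurable_comp bH.
  apply: bounded_measurableM; last exact: bounded_measurable_comp bcw.
  apply: bounded_measurableM => //.
  apply: bounded_measurableM; last exact: bounded_measurable_kernel.
  exact: bounded_measurable_comp bphi.
transitivity (Cintegral (fun t => Cintegral (fun u => E (t, u)))).
  congr Cintegral; apply/funext => t.
  rewrite -[contour_int _ _]/(nested (f :: fs) _) nested_cons.
  rewrite mulrAC -CintegralZ; last first.
    by apply: bm_integrand => //; exact: tame_kernel.
  by congr Cintegral; apply/funext => u; rewrite /E /=; ring.
rewrite Cintegral_swap //.
rewrite (_ : (fun _ => _) = (fun=> 0 : R[i])); last first.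
  apply/funext => u; rewrite /E /= CintegralZ; last first.
    apply: bounded_measurableM => //; apply: bounded_measurableM.
      by apply: bounded_measurableM => //; exact: tame_kernel_l.
    apply: (bounded_measurable_comp (phi := fun t : R => (t, u)) _ bnest).
    exact: pair2_measurable.
  rewrite (_ : Cintegral _ = 0) ?mulr0 //.
  under eq_fun do under eq_fun do rewrite mulrAC.
  apply: (IH (fun z => phi z * kernel z (G u)) (fun v => H v * kernel (G u) v)) => //.
  - by apply: bounded_measurableM => //; exact: tame_kernel_l.
  - exact: tame_kernel.
  - move=> vs; have := phi0 (u :: vs).
    by under eq_fun do rewrite big_cons mulrA.
by apply: complexP; rewrite /= Rintegral01_cst.
Qed.

(** Equality is asked on the curve only, because factors such as 1 - s u and u - s are cancelled,
    which may vanish elsewhere. *)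
Fixpoint eq_on_curve (fs fs' : seq (R[i] -> R[i])) : Prop :=
  match fs, fs' with
  | [::], [::] => True
  | f :: fs, f' :: fs' => (forall t, f (G t) = f' (G t)) /\ eq_on_curve fs fs'
  | _, _ => False
  end.

Lemma eq_on_curve_refl fs : eq_on_curve fs fs.
Proof. by elim: fs. Qed.

Lemma eq_on_curve_cat fs1 fs2 fs1' fs2' : eq_on_curve fs1 fs1' ->
  eq_on_curve fs2 fs2' -> eq_on_curve (fs1 ++ fs2) (fs1' ++ fs2').
Proof. by elim: fs1 fs1' => [|f fs IH] [|f' fs'] //= [? ?] ?; split=> //; exact: IH. Qed.

Lemma eq_on_curve_nseq n f f' :
  (forall t, f (G t) = f' (G t)) -> eq_on_curve (nseq n f) (nseq n f').
Proof. by move=> ff'; elim: n => //= n IH; split. Qed.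

Lemma nested_eq fs fs' H : eq_on_curve fs fs' -> nested fs H = nested fs' H.
Proof.
elim: fs fs' H => [|f fs IH] [|f' fs'] H //; rewrite -/eq_on_curve => -[ff' e].
rewrite !nested_cons; congr Cintegral; apply/funext => t.
by rewrite ff' (IH _ _ e).
Qed.

End NestedIntegrals.

(** * Piecewise C^1 curves *)

Section PiecewiseCurves.
Context {R : realType}.
Implicit Types (g f : R -> R[i]) (a b t : R) (ts : seq R).

Fixpoint piecewise_from g a ts : Prop :=
  if ts is b :: ts' then
    [/\ a < b, exists2 f, C1_curve f & {in `[a, b], g =1 f}
      & piecewise_from g b ts']
  else True.

Lemma piecewise_C1_from g : piecewise_C1 g ->
  exists2 ts, last 0 ts = 1 & piecewise_from g 0 ts.
Proof.
case=> ts [pts /eqP lts] pc; exists ts => //.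
have gen a : path <%R a ts -> (forall i, (i < size ts)%N -> exists2 f,
    C1_curve f & {in `[nth 0 (a :: ts) i, nth 0 ts i], g =1 f}) ->
    piecewise_from g a ts.
  elim: ts {pts pc lts} a => [|b ts IH] a //= /andP[ab pts] pc; split=> //.
  - exact: (pc 0%N).
  - by apply: IH => // i its; exact: (pc i.+1).
exact: gen.
Qed.

Lemma piecewise_from_le g a ts : piecewise_from g a ts -> a <= last a ts.
Proof.
elim: ts a => [|b ts IH] a //= [ab _ /IH]; exact/le_trans/ltW.
Qed.

Definition clamp a b t := Order.max a (Order.min t b).

Lemma clamp_in a b t : a <= b -> clamp a b t \in `[a, b].
Proof.
by move=> ab; rewrite in_itv /= le_max lexx /= ge_max ab /= ge_min lexx orbT.
Qed.

Lemma clamp_id a b t : t \in `[a, b] -> clamp a b t = t.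
Proof.
by rewrite in_itv /= => /andP[at_ tb]; rewrite /clamp min_l // max_r.
Qed.

Lemma continuous_clamp a b : continuous (clamp a b : R -> R).
Proof.
move=> t; apply: (@continuous_max _ R (cst a) (Order.min^~ b)).
  exact: cst_continuous.
by apply: (@continuous_min _ R id (cst b)); [exact: cvg_id | exact: cst_continuous].
Qed.

(** Writes a function glued at [b] as a sum, so that its continuity follows from that of the two
    pieces with no case analysis at [b]. *)
Lemma clamp_glue (h : R -> R) a b c t : a <= b -> b <= c ->
  h (clamp a c t) = h (clamp a b t) + h (clamp b c t) - h b.
Proof.
move=> ab bc; rewrite /clamp; have [tb|/ltW bt] := leP t b.
  rewrite (min_l (le_trans tb bc)) (max_l tb).
  by rewrite addrK.
have -> : Order.max a b = b by apply: max_r.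
have bm : b <= Order.min t c by rewrite le_min bt bc.
by rewrite (max_r bm) (max_r (le_trans ab bm)) addrAC subrr add0r.
Qed.

Section Part.
(** Stands for the real or the imaginary part, so that each argument is made once. *)
Variable part : R[i] -> R.
Hypothesis part_deriv : forall f, C1_curve f ->
  (forall t, derivable (fun t => part (f t)) t 1) /\
  continuous (derive1 (fun t => part (f t))).
Hypothesis partE : forall f t, part (Cderive f t) = derive1 (fun t => part (f t)) t.

Lemma continuous_piecewise_clamp g a ts : piecewise_from g a ts ->
  continuous (fun t => part (g (clamp a (last a ts) t))).
Proof.
elim: ts a => [|b ts IH] a /=.
  move=> _; have -> : (fun t => part (g (clamp a a t))) = cst (part (g a)).
    apply/funext => t; rewrite /clamp /=; congr (part (g _)).
    by apply: max_l; rewrite ge_min lexx orbT.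
  exact: cst_continuous.
move=> [ab [f C1f gf] pw] t.
have bl := piecewise_from_le pw.
have -> : (fun t => part (g (clamp a (last b ts) t))) =
    (fun t => part (f (clamp a b t)) + part (g (clamp b (last b ts) t)) - part (g b)).
  apply/funext => u; rewrite (clamp_glue (fun t => part (g t)) u (ltW ab) bl).
  by rewrite gf // clamp_in // ltW.
apply: cvgB; last exact: cvg_cst.
apply: cvgD; last exact: IH.
apply: (@continuous_comp _ _ _ (clamp a b) (fun t => part (f t))).
  exact: continuous_clamp.
have [df _] := part_deriv C1f.
exact/differentiable_continuous/derivable1_diffP.
Qed.

Lemma derive1_piece g f a b t : {in `[a, b], g =1 f} -> t \in `]a, b[ ->
  derive1 (fun t => part (g t)) t = derive1 (fun t => part (f t)) t.
Proof.
move=> gf tab; rewrite !derive1E; apply: near_eq_derive.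
near=> u; rewrite gf //.
apply: subset_itv_oo_cc; near: u; exact: near_in_itvoo.
Unshelve. all: by end_near. Qed.

Lemma measurable_piecewise_deriv g a ts : piecewise_from g a ts ->
  measurable_fun `[a, last a ts] (derive1 (fun t => part (g t))) /\
  exists M : R, forall t, t \in `[a, last a ts] ->
     `|derive1 (fun t => part (g t)) t| <= M.
Proof.
elim: ts a => [|b ts IH] a /=.
  move=> _; split; first by rewrite set_itv1; exact: measurable_fun_set1.
  exists `|derive1 (fun t => part (g t)) a| => t.
  by rewrite in_itv /= -eq_le => /eqP <-.
move=> [ab [f C1f gf] pw].
have bl := piecewise_from_le pw.
have [mg [M gM]] := IH _ pw.
have [_ cf] := part_deriv C1f.
split.
  have -> : (`[a, last b ts] = `[a, b] `|` `[b, last b ts])%classic.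
    apply/seteqP; split => t /=; rewrite !in_itv /=.
      move=> /andP[at_ tl]; rewrite at_ tl /=.
      by rewrite andbT; case: (leP t b) => [|/ltW ->]; [left|right].
    move=> [] /andP[h h'].
      by rewrite h (le_trans h' bl).
    by rewrite h' (le_trans (ltW ab) h).
  apply/measurable_funU => //; split=> //.
  (* The open interval suffices; at its ends the derivative of [g] need not be that of the arc. *)
  apply: (@measurable_fun_itv_cc _ _ _ false true).
  apply: (eq_measurable_fun (derive1 (fun t => part (f t)))).
    by move=> t /set_mem /= tab; rewrite (derive1_piece gf tab).
  by apply: measurable_funTS; exact: continuous_measurable_fun.
have [c cab fc] := @EVT_max _ (fun t => `|derive1 (fun t => part (f t)) t|) a b (ltW ab)
  (continuous_subspaceT (fun t => continuous_comp (cf t) (@norm_continuous _ _ _))).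
pose D t := `|derive1 (fun t => part (g t)) t|.
(* The value at a corner is arbitrary, so it has to enter the bound separately. *)
exists (Order.max M (Order.max (D a) (Order.max (D b) `|derive1 (fun t => part (f t)) c|))).
move=> t; rewrite in_itv /= => /andP[at_ tl].
rewrite !le_max; have [bt|tb] := leP b t.
  by rewrite gM // in_itv /= bt tl.
move: at_; rewrite le_eqVlt => /orP[/eqP <-|at_]; first by rewrite /D lexx orbT.
rewrite (derive1_piece gf) ?in_itv /= ?at_ ?tb // fc ?orbT //.
by rewrite in_itv /= !ltW.
Qed.

End Part.

End PiecewiseCurves.

(** * Continuity of complex functions through real and imaginary parts *)

Section ComplexContinuity.
Context {R : realType} {T : topologicalType}.
Implicit Types (f h : T -> R[i]) (t : T).

Definition Ccontinuous_at f t : Prop :=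
  {for t, continuous (fun t => complex.Re (f t))} /\
  {for t, continuous (fun t => complex.Im (f t))}.

Lemma eq_continuous_for (F H : T -> R) t : F =1 H ->
  {for t, continuous H} -> {for t, continuous F}.
Proof. by move=> /funext ->. Qed.

Lemma Ccontinuous_cst (c : R[i]) t : Ccontinuous_at (fun _ : T => c) t.
Proof. by split; exact: cst_continuous. Qed.

Lemma CcontinuousD f h t : Ccontinuous_at f t -> Ccontinuous_at h t ->
  Ccontinuous_at (fun t => f t + h t) t.
Proof.
move=> [rf jf] [rh jh]; split.
- by apply: (eq_continuous_for (fun u => Re_add _ _)); exact: continuousD.
- by apply: (eq_continuous_for (fun u => Im_add _ _)); exact: continuousD.
Qed.

Lemma CcontinuousM f h t : Ccontinuous_at f t -> Ccontinuous_at h t ->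
  Ccontinuous_at (fun t => f t * h t) t.
Proof.
move=> [rf jf] [rh jh]; split.
- apply: (eq_continuous_for (fun u => Re_mul _ _)).
  by apply: continuousB; exact: continuousM.
- apply: (eq_continuous_for (fun u => Im_mul _ _)).
  by apply: continuousD; exact: continuousM.
Qed.

Lemma CcontinuousX f n t : Ccontinuous_at f t ->
  Ccontinuous_at (fun t => f t ^+ n) t.
Proof.
move=> cf; elim: n => [|n IH]; first exact: Ccontinuous_cst.
by have := CcontinuousM cf IH; congr Ccontinuous_at; apply/funext => u; rewrite exprS.
Qed.

Lemma continuous_normc_sqr f t : Ccontinuous_at f t ->
  {for t, continuous (fun t => normc (f t) ^+ 2)}.
Proof.
move=> [rf jf]; apply: (eq_continuous_for (fun u => normc_sqr _)).
by apply: continuousD; exact: continuousM.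
Qed.

Lemma CcontinuousV f t : f t != 0 -> Ccontinuous_at f t ->
  Ccontinuous_at (fun t => (f t)^-1) t.
Proof.
move=> f0 cf; have cN := continuous_normc_sqr cf; case: cf => rf jf.
have cV : {for t, continuous (fun t => (normc (f t) ^+ 2)^-1)}.
  by apply: continuousV => //; rewrite sqrf_eq0 normc_eq0.
split.
- by apply: (eq_continuous_for (fun u => Re_inv _)); exact: continuousM.
- apply: (eq_continuous_for (fun u => Im_inv _)).
  by apply: continuousM => //; exact: continuousN.
Qed.

Lemma continuous_normc f t : Ccontinuous_at f t ->
  {for t, continuous (fun t => normc (f t))}.
Proof.
move=> cf.
apply: (@eq_continuous_for _ (Num.sqrt \o (fun t => normc (f t) ^+ 2))) => [u|].
  by rewrite /= sqrtr_sqr ger0_norm // normc_ge0.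
apply: continuous_comp; first exact: continuous_normc_sqr.
exact: sqrt_continuous.
Qed.

End ComplexContinuity.

(** * Derivatives of complex functions of a real variable *)

Section ComplexCurves.
Context {R : realType}.
Implicit Types (f g h : R -> R[i]) (a b t : R).

Definition is_Cderive f t (d : R[i]) : Prop :=
  is_derive t 1 (fun t => complex.Re (f t)) (complex.Re d) /\
  is_derive t 1 (fun t => complex.Im (f t)) (complex.Im d).

Lemma is_Cderive_cst c t : is_Cderive (fun=> c) t 0.
Proof. by split; exact: is_derive_cst. Qed.

Lemma is_CderiveD f h t d d' : is_Cderive f t d -> is_Cderive h t d' ->
  is_Cderive (fun t => f t + h t) t (d + d').
Proof.
move=> [rf jf] [rh jh]; split.
- rewrite Re_add; have := is_deriveD rf rh; congr is_derive.
  by apply/funext => u; rewrite Re_add.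
- rewrite Im_add; have := is_deriveD jf jh; congr is_derive.
  by apply/funext => u; rewrite Im_add.
Qed.

Lemma is_CderiveM f h t d d' : is_Cderive f t d -> is_Cderive h t d' ->
  is_Cderive (fun t => f t * h t) t (f t * d' + h t * d).
Proof.
move=> [rf jf] [rh jh]; split.
- have := is_deriveB (is_deriveM rf rh) (is_deriveM jf jh).
  move=> /(is_derive_eq (df := complex.Re (f t * d' + h t * d))) => h1.
  have : is_derive t 1 (fun u => complex.Re (f u * h u))
      (complex.Re (f t * d' + h t * d)); last by [].
  rewrite (_ : (fun u => _) =
    ((fun t0 : R => complex.Re (f t0)) * (fun t0 : R => complex.Re (h t0)) -
   (fun t0 : R => complex.Im (f t0)) * (fun t0 : R => complex.Im (h t0)))%R); last first.
    by apply/funext => u; rewrite Re_mul.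
  by apply: h1; rewrite Re_add !Re_mul /GRing.scale /=; ring.
- have := is_deriveD (is_deriveM rf jh) (is_deriveM jf rh).
  move=> /(is_derive_eq (df := complex.Im (f t * d' + h t * d))) => h1.
  have : is_derive t 1 (fun u => complex.Im (f u * h u))
      (complex.Im (f t * d' + h t * d)); last by [].
  rewrite (_ : (fun u => _) =
    ((fun t0 : R => complex.Re (f t0)) * (fun t0 : R => complex.Im (h t0)) +
   (fun t0 : R => complex.Im (f t0)) * (fun t0 : R => complex.Re (h t0)))%R); last first.
    by apply/funext => u; rewrite Im_mul.
  by apply: h1; rewrite Im_add !Im_mul /GRing.scale /=; ring.
Qed.

Lemma is_CderiveV f t d : f t != 0 -> is_Cderive f t d ->
  is_Cderive (fun t => (f t)^-1) t (- (f t)^-1 ^+ 2 * d).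
Proof.
move=> f0 [rf jf].
have N0 : complex.Re (f t) ^+ 2 + complex.Im (f t) ^+ 2 != 0.
  by rewrite -normc_sqr sqrf_eq0 normc_eq0.
pose N u := complex.Re (f u) ^+ 2 + complex.Im (f u) ^+ 2.
have dN : is_derive t 1 N (2 * complex.Re (f t) * complex.Re d
    + 2 * complex.Im (f t) * complex.Im d).
  have := is_deriveD (is_deriveM rf rf) (is_deriveM jf jf).
  move=> /(is_derive_eq (df := 2 * complex.Re (f t) * complex.Re d
    + 2 * complex.Im (f t) * complex.Im d)) h1.
  by apply: h1; rewrite /GRing.scale /=; ring.
have dV := @is_deriveV R N t _ 1 N0 dN.
have E1 : complex.Re (- (f t)^-1 ^+ 2 * d) =
    complex.Re (f t) * (- N t ^- 2 * (2 * complex.Re (f t) * complex.Re d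
    + 2 * complex.Im (f t) * complex.Im d)) + (N t)^-1 * complex.Re d.
  rewrite mulNr -mulrN expr2 !Re_mul !Im_mul !Re_inv !Im_inv normc_sqr /N.
  have -> : complex.Re (- d) = - complex.Re d by case: (d).
  have -> : complex.Im (- d) = - complex.Im d by case: (d).
  by field.
have E2 : complex.Im (- (f t)^-1 ^+ 2 * d) =
    - (complex.Im (f t) * (- N t ^- 2 * (2 * complex.Re (f t) * complex.Re d
    + 2 * complex.Im (f t) * complex.Im d)) + (N t)^-1 * complex.Im d).
  rewrite mulNr -mulrN expr2 !Im_mul !Re_mul !Re_inv !Im_inv normc_sqr /N.
  have -> : complex.Re (- d) = - complex.Re d by case: (d).
  have -> : complex.Im (- d) = - complex.Im d by case: (d).
  by field.
split.
- rewrite E1; have := is_deriveM rf dV; congr is_derive.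
  by apply/funext => u; rewrite Re_inv normc_sqr.
- rewrite E2; have := is_deriveN (is_deriveM jf dV); congr is_derive.
  by apply/funext => u; rewrite Im_inv normc_sqr mulNr.
Qed.

Lemma is_CderiveX f t d n : is_Cderive f t d ->
  is_Cderive (fun t => f t ^+ n.+1) t (n.+1%:R * f t ^+ n * d).
Proof.
move=> df; elim: n => [|n IH].
  by rewrite mulr1 mul1r.
have := is_CderiveM df IH.
rewrite -[(fun t => f t * f t ^+ n.+1)]/(fun t => f t ^+ n.+2).
by congr is_Cderive; rewrite [in RHS]mulrSr exprS; ring.
Qed.

Lemma C1_curve_Cderive f t : C1_curve f -> is_Cderive f t (Cderive f t).
Proof.
by move=> [rf jf _ _]; split; rewrite /= derive1E; exact: derivableP.
Qed.

Lemma C1_curve_continuous f t : C1_curve f ->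
  Ccontinuous_at f t /\ Ccontinuous_at (Cderive f) t.
Proof.
move=> [rf jf crf cjf]; split; split.
- exact/differentiable_continuous/derivable1_diffP.
- exact/differentiable_continuous/derivable1_diffP.
- exact: crf.
- exact: cjf.
Qed.

Lemma bounded_measurable_clamp f : (forall t, Ccontinuous_at f t) ->
  bounded_measurable (fun t => f (clamp 0 1 t)).
Proof.
move=> cf; split.
- apply: continuous_measurable_fun => t.
  apply: (@continuous_comp _ _ _ (clamp 0 1) (fun t => complex.Re (f t))).
    exact: continuous_clamp.
  by have [] := cf (clamp 0 1 t).
- apply: continuous_measurable_fun => t.
  apply: (@continuous_comp _ _ _ (clamp 0 1) (fun t => complex.Im (f t))).
    exact: continuous_clamp.
  by have [] := cf (clamp 0 1 t).
- have [c _ cmax] := @EVT_max _ (fun t => normc (f t)) 0 1 ler01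
    (continuous_subspaceT (fun t => continuous_normc (cf t))).
  by exists (normc (f c)) => t; apply: cmax; exact: clamp_in.
Qed.

End ComplexCurves.

(** * Contour integrals of functions having a primitive *)

Section ContourIntegrals.
Context {R : realType}.
Local Notation mu := (@lebesgue_measure R).
Variable g : R -> R[i].
Hypothesis pg : piecewise_C1 g.

Definition point t : R[i] := g (clamp 0 1 t).

(** Set to 0 outside [[0, 1]], where nothing is known of [g]: this makes it bounded and measurable
    on the whole line. *)
Definition velocity t : R[i] := if t \in `[0, 1] then Cderive g t else 0.

Lemma point_on_curve t : curve_image g (point t).
Proof. by exists (clamp 0 1 t) => //; exact: clamp_in. Qed.

Lemma curve_imageP z : curve_image g z -> exists t, z = point t.
Proof. by move=> [t t01 <-]; exists t; rewrite /point clamp_id. Qed.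

Lemma contour_intE f :
  contour_int g f = Cintegral (fun t => f (point t) * velocity t).
Proof.
by apply: eq_Cintegral => t t01; rewrite /point clamp_id // /velocity t01.
Qed.

Let re_deriv (f : R -> R[i]) : C1_curve f ->
  (forall t, derivable (fun t => complex.Re (f t)) t 1) /\
  continuous (derive1 (fun t => complex.Re (f t))).
Proof. by case. Qed.

Let im_deriv (f : R -> R[i]) : C1_curve f ->
  (forall t, derivable (fun t => complex.Im (f t)) t 1) /\
  continuous (derive1 (fun t => complex.Im (f t))).
Proof. by case. Qed.

Lemma Ccontinuous_point t : Ccontinuous_at point t.
Proof.
have [ts l1 pw] := piecewise_C1_from pg; rewrite /point -l1; split.
- exact: (continuous_piecewise_clamp re_deriv pw).
- exact: (continuous_piecewise_clamp im_deriv pw).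
Qed.

Lemma bounded_measurable_comp_point (f : R[i] -> R[i]) :
  (forall t, Ccontinuous_at (fun t => f (point t)) t) ->
  bounded_measurable (fun t => f (point t)).
Proof.
move=> cf; have := bounded_measurable_clamp cf; congr bounded_measurable.
by apply/funext => t; rewrite /point (clamp_id (clamp_in _ _)).
Qed.

Lemma bounded_measurable_point : bounded_measurable point.
Proof.
by apply: (bounded_measurable_comp_point (f := id)); exact: Ccontinuous_point.
Qed.

Lemma bounded_measurable_velocity : bounded_measurable velocity.
Proof.
have [ts l1 pw] := piecewise_C1_from pg.
have [mr [M rM]] := measurable_piecewise_deriv re_deriv pw.
have [mi [N iN]] := measurable_piecewise_deriv im_deriv pw.
rewrite l1 in mr rM mi iN.
have part (p : R[i] -> R) : p 0 = 0 ->
    measurable_fun (`[0, 1]%classic : set R) (fun t => p (Cderive g t)) ->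
    measurable_fun setT (fun t => p (velocity t)).
  move=> p0 mp; have {}mp := (measurable_restrictT _ (measurable_itv _)).1 mp.
  rewrite (_ : (fun _ => _) =
    (fun t => p (Cderive g t)) \_ (`[0, 1]%classic : set R)); first exact: mp.
  by apply/funext => t; rewrite /velocity /patch mem_setE; case: ifPn.
split; [exact: part|exact: part|].
exists (Order.max 0 (M + N)) => t; rewrite /velocity le_max.
case: ifPn => t01; last by rewrite normc0 lexx.
apply/orP; right; apply: le_trans (normc_le_ReIm _) _.
by apply: lerD; [exact: rM | exact: iN].
Qed.

Lemma Cderive_piece (f : R -> R[i]) a b t : {in `[a, b], g =1 f} ->
  t \in `]a, b[ -> Cderive g t = Cderive f t.
Proof.
move=> gf tab; congr Complex.
- exact: (derive1_piece (@complex.Re R) gf tab).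
- exact: (derive1_piece (@complex.Im R) gf tab).
Qed.

Lemma Rintegral_FTC2 (psi Phi : R -> R) a b : a < b ->
  (forall t, t \in `[a, b] -> {for t, continuous psi}) ->
  (forall t, t \in `[a, b] -> is_derive t 1 Phi (psi t)) ->
  \int[mu]_(t in `[a, b]) psi t = Phi b - Phi a.
Proof.
move=> ab cpsi dPhi.
have cPhi t : t \in `[a, b] -> {for t, continuous Phi}.
  move=> tab; apply/differentiable_continuous/derivable1_diffP.
  by have [] := dPhi t tab.
have aab : a \in `[a, b] by rewrite in_itv /= lexx ltW.
have bab : b \in `[a, b] by rewrite in_itv /= lexx ltW.
rewrite /Rintegral (continuous_FTC2 ab (F := Phi)) //.
- by apply: continuous_in_subspaceT => t /set_mem; exact: cpsi.
- split.
  + by move=> t /subset_itv_oo_cc tab; have [] := dPhi t tab.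
  + exact/cvg_at_right_filter/cPhi.
  + exact/cvg_at_left_filter/cPhi.
- move=> t /subset_itv_oo_cc tab; rewrite derive1E.
  by have [_ ->] := dPhi t tab.
Qed.

(** Expressed by the chain rule along real curves at points of the contour: no complex derivative is
    needed, and [F] may have poles off the contour. *)
Definition is_primitive (F f : R[i] -> R[i]) : Prop :=
  (forall (h : R -> R[i]) t d, is_Cderive h t d -> curve_image g (h t) ->
     is_Cderive (fun t => F (h t)) t (f (h t) * d)) /\
  (forall (h : R -> R[i]) t, Ccontinuous_at h t -> curve_image g (h t) ->
     Ccontinuous_at (fun t => f (h t)) t).

(* Each arc is integrated by the fundamental theorem of calculus; at its ends
   [Cderive g] may differ from the derivative of the arc. *)
Lemma contour_int_primitive F f : g 0 = g 1 -> is_primitive F f ->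
  contour_int g f = 0.
Proof.
move=> g01 [dF cf].
pose phi t := f (g t) * Cderive g t.
have bphi : bounded_measurable (fun t => f (point t) * velocity t).
  apply: bounded_measurableM bounded_measurable_velocity.
  apply: bounded_measurable_comp_point => t; apply: cf.
    exact: Ccontinuous_point.
  exact: point_on_curve.
have [ri ii] := bounded_measurable_integrable bphi.
have phiE t : t \in `[0, 1] -> f (point t) * velocity t = phi t.
  by move=> t01; rewrite /point clamp_id // /velocity t01.
have main (p : R[i] -> R) :
    (forall h t d, is_Cderive h t d -> is_derive t 1 (fun t => p (h t)) (p d)) ->
    (forall (h : R -> R[i]) (t : R), Ccontinuous_at h t ->
       {for t, continuous (fun t => p (h t))}) ->
    mu.-integrable `[0, 1] (EFin \o (fun t => p (phi t))) ->
    \int[mu]_(t in `[0, 1]) p (phi t) = 0.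
  move=> pd pc ip.
  have [ts l1 pw] := piecewise_C1_from pg.
  have gen ts' a : piecewise_from g a ts' -> last a ts' <= 1 -> 0 <= a ->
      \int[mu]_(t in `[a, last a ts']) p (phi t) =
      p (F (g (last a ts'))) - p (F (g a)).
    elim: ts' a {ts l1 pw} => [|b ts IH] a /=.
      by move=> _ _ _; rewrite set_itv1 Rintegral_set1 subrr.
    move=> [ab [h C1h gh] pw] l1 a0.
    have bl := piecewise_from_le pw.
    have ipab : mu.-integrable `[a, last b ts] (EFin \o (fun t => p (phi t))).
      apply: integrableS ip => // t /=; rewrite !in_itv /= => /andP[at_ tl].
      by rewrite (le_trans a0 at_) (le_trans tl l1).
    have := @Rintegral_itvB _ _ (BLeft a) (BRight (last b ts)) b ipab.
    rewrite !bnd_simp (ltW ab) bl => /(_ isT isT) /eqP.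
    rewrite subr_eq => /eqP ->.
    rewrite Rintegral_itv_obnd_cbnd; last first.
      apply: integrableS ipab => // t /=; rewrite !in_itv /= => /andP[bt ->].
      by rewrite (le_trans (ltW ab) (ltW bt)).
    rewrite (IH b pw l1 (le_trans a0 (ltW ab))).
    suff -> : \int[mu]_(t in `[a, b]) p (phi t) = p (F (g b)) - p (F (g a)).
      by ring.
    have aab : a \in `[a, b] by rewrite in_itv /= lexx ltW.
    have bab : b \in `[a, b] by rewrite in_itv /= lexx ltW.
    have hC t : t \in `[a, b] -> curve_image g (h t).
      move=> tab; exists t; last by rewrite gh.
      move: tab; rewrite /= !in_itv /= => /andP[at_ tb].
      by rewrite (le_trans a0 at_) (le_trans tb (le_trans bl l1)).
    rewrite -(Rintegral_itv_obnd_cbnd (b := BRight b)); last first.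
      apply: integrableS ipab => // t /=; rewrite !in_itv /= => /andP[/ltW -> tb].
      by rewrite (le_trans tb bl).
    rewrite -Rintegral_itv_bndo_bndc; last first.
      apply: integrableS ipab => // t /=; rewrite !in_itv /= => /andP[/ltW -> /ltW tb].
      by rewrite (le_trans tb bl).
    pose psi t := p (f (h t) * Cderive h t).
    have cpsi t : t \in `[a, b] -> {for t, continuous psi}.
      move=> tab; have [ch ch'] := C1_curve_continuous t C1h.
      by apply: pc; apply: CcontinuousM => //; apply: cf => //; exact: hC.
    transitivity (\int[mu]_(t in `]a, b[) psi t).
      apply: eq_Rintegral => t; move=> /set_mem /= tab.
      rewrite /phi /psi (Cderive_piece gh tab) gh //.
      exact: subset_itv_oo_cc.
    have ipsi : mu.-integrable `[a, b] (EFin \o psi).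
      apply: continuous_compact_integrable; first exact: segment_compact.
      by apply: continuous_in_subspaceT => t /set_mem; exact: cpsi.
    rewrite Rintegral_itv_bndo_bndc; last first.
      by apply: integrableS ipsi => //; exact: subset_itv_oo_cc.
    rewrite Rintegral_itv_obnd_cbnd; last first.
      by apply: integrableS ipsi => //; exact: subset_itv_oc_cc.
    rewrite (gh _ aab) (gh _ bab).
    apply: (@Rintegral_FTC2 _ (fun t => p (F (h t)))) => // t tab.
    by apply: pd; apply: dF; [exact: C1_curve_Cderive | exact: hC].
  by have := gen _ _ pw; rewrite l1 -g01 subrr => ->.
apply: complexP; rewrite /contour_int ?Re_Cintegral ?Im_Cintegral.
- apply: main => [h t d []//|h t []//|].
  by apply: eq_integrable ri => // t /set_mem /= t01; rewrite /= phiE.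
- apply: main => [h t d []//|h t []//|].
  by apply: eq_integrable ii => // t /set_mem /= t01; rewrite /= phiE.
Qed.

Lemma contour_int_exp n : g 0 = g 1 -> contour_int g (fun u => u ^+ n) = 0.
Proof.
move=> g01.
apply: (@contour_int_primitive (fun u => n.+1%:R^-1 * u ^+ n.+1)) => //; split.
- move=> h t d dh _.
  have := is_CderiveM (is_Cderive_cst n.+1%:R^-1 t) (is_CderiveX n dh).
  by congr is_Cderive; rewrite mulr0 addr0 !mulrA mulVf ?mul1r // pnatr_eq0.
- by move=> h t ch _; exact: CcontinuousX.
Qed.

Lemma contour_int_expV z n : g 0 = g 1 -> ~ curve_image g z ->
  contour_int g (fun u => (u - z)^-1 ^+ n.+2) = 0.
Proof.
move=> g01 zC.
have nz (h : R -> R[i]) t : curve_image g (h t) -> h t - z != 0.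
  by move=> hC; rewrite subr_eq0; apply/eqP => hz; apply: zC; rewrite -hz.
apply: (@contour_int_primitive (fun u => - n.+1%:R^-1 * (u - z)^-1 ^+ n.+1)) => //; split.
- move=> h t d dh /nz ht.
  have dhz := is_CderiveD dh (is_Cderive_cst (- z) t).
  have dV := is_CderiveV ht dhz.
  have := is_CderiveM (is_Cderive_cst (- n.+1%:R^-1) t) (is_CderiveX n dV).
  congr is_Cderive; rewrite mulr0 !addr0 -[n.+2]addn2 exprD.
  have k0 : n.+1%:R != 0 :> R[i] by rewrite pnatr_eq0.
  by move: (n.+1%:R) k0 (h t - z)^-1 => k k0 w; field.
- move=> h t ch /nz ht; apply: CcontinuousX; apply: CcontinuousV => //.
  by apply: CcontinuousD => //; exact: Ccontinuous_cst.
Qed.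

End ContourIntegrals.

(** * Winding numbers and rational integrands *)

Section Winding.
Context {R : realType}.
Variable g : R -> R[i].
Hypothesis pg : piecewise_C1 g.
Hypothesis g01 : g 0 = g 1.

Local Notation point := (point g).
Local Notation velocity := (velocity g).
Local Notation tame_on := (tame point).
Local Notation cint := (contour_int g).

(** This is [two_pi_i] times the winding number. Its local constancy off the curve takes the place
    of the homotopy form of Cauchy's theorem. *)
Definition cauchy_transform z : R[i] := cint (fun u => (u - z)^-1).

Lemma contour_intD f h : tame_on f -> tame_on h ->
  cint (fun u => f u + h u) = cint f + cint h.
Proof.
move=> bf bh; have bv := bounded_measurable_velocity pg.
rewrite !contour_intE -CintegralD; [|exact: bounded_measurableM..].
by congr Cintegral; apply/funext => t; rewrite mulrDl.
Qed.

Lemma contour_intZ f c : tame_on f ->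
  cint (fun u => c * f u) = c * cint f.
Proof.
move=> bf; have bv := bounded_measurable_velocity pg.
rewrite !contour_intE -CintegralZ; last exact: bounded_measurableM.
by congr Cintegral; apply/funext => t; rewrite mulrA.
Qed.

Lemma eq_contour_int f h : (forall u, curve_image g u -> f u = h u) ->
  cint f = cint h.
Proof.
move=> fh; rewrite !contour_intE; congr Cintegral; apply/funext => t.
by rewrite fh //; exact: point_on_curve.
Qed.

Lemma contour_int0 : cint (fun=> 0) = 0.
Proof.
rewrite contour_intE; under eq_fun do rewrite mul0r.
by apply: complexP; rewrite /= Rintegral01_cst.
Qed.

Lemma normc_contour_int : exists2 V : R, 0 <= V &
  forall f (M : R), tame_on f -> (forall t, normc (f (point t)) <= M) ->
  normc (cint f) <= M * V.
Proof.
have bv := bounded_measurable_velocity pg; have [_ _ [N vN]] := bv.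
have N0 : 0 <= N by apply: le_trans (vN 0); exact: normc_ge0.
exists (N + N); first by rewrite addr_ge0.
move=> f M bf fM; rewrite contour_intE mulrDr.
apply: normc_Cintegral; first exact: bounded_measurableM.
by move=> t; rewrite normcM ler_pM // normc_ge0.
Qed.

Lemma curve_dist z : ~ curve_image g z ->
  exists2 e : R, 0 < e & forall t, e <= normc (point t - z).
Proof.
move=> zC.
have cz t : {for t, continuous (fun t => normc (point t - z))}.
  apply: continuous_normc; apply: CcontinuousD; first exact: Ccontinuous_point.
  exact: Ccontinuous_cst.
have [c _ cmin] := @EVT_min _ (fun t => normc (point t - z)) 0 1 ler01
  (continuous_subspaceT cz).
exists (normc (point c - z)).
  rewrite normc_gt0 subr_eq0; apply/eqP => pz; apply: zC; rewrite -pz.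
  exact: point_on_curve.
move=> t; have := cmin _ (clamp_in t ler01).
by rewrite /point (clamp_id (clamp_in t ler01)).
Qed.

Lemma tame_cst c : tame_on (fun=> c).
Proof. exact: bounded_measurable_cst. Qed.

Lemma tame_id : tame_on id.
Proof. exact: bounded_measurable_point. Qed.

Lemma tameB z : tame_on (fun u => u - z).
Proof.
by apply: bounded_measurableD; [exact: tame_id | exact: tame_cst].
Qed.

Lemma tameV z : ~ curve_image g z -> tame_on (fun u => (u - z)^-1).
Proof.
move=> /curve_dist[e e0 ez].
by apply: (bounded_measurableV e0) => //; exact: tameB.
Qed.

Lemma geometric_bound_eq0 (x C r : R) : 0 <= x -> 0 <= r -> r < 1 ->
  (forall n, x <= C * r ^+ n) -> x = 0.
Proof.
move=> x0 r0 r1 xC; apply/eqP; rewrite eq_le x0 andbT.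
have cr : (fun n => C * r ^+ n) @ \oo --> C * 0.
  by apply: cvgMr; apply: cvg_expr; rewrite ger0_norm.
rewrite mulr0 in cr; rewrite -(cvg_lim _ cr) //.
by apply: limr_ge; [apply/cvg_ex; exists 0 | apply: nearW].
Qed.

(* Telescoping of the finite geometric series: only the first power of
   [(u - z)^-1] has a nonzero contour integral. *)
Lemma cauchy_transform_near z z' (e : R) : 0 < e ->
  (forall t, e <= normc (point t - z)) -> normc (z' - z) < e / 2 ->
  cauchy_transform z' = cauchy_transform z.
Proof.
move=> e0 ez zz'.
have zC : ~ curve_image g z.
  by move=> /curve_imageP[t zt]; have := ez t; rewrite zt subrr normc0 leNgt e0.
have z'e t : e / 2 <= normc (point t - z').
  have -> : point t - z' = (point t - z) - (z' - z) by ring.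
  have := ez t; have := normcB_ge (point t - z) (z' - z); lra.
have z'C : ~ curve_image g z'.
  by move=> /curve_imageP[t zt]; have := z'e t; rewrite zt subrr normc0; lra.
set d := z' - z in zz' *.
have az := tameV zC; have az' := tameV z'C.
have nz u : curve_image g u -> (u - z != 0) && (u - z' != 0).
  by move=> uC; rewrite !subr_eq0; apply/andP; split; apply/eqP => E;
    [apply: zC | apply: z'C]; rewrite -E.
(* Remainder after n terms of the geometric expansion of 1 / (u - z') in powers of d / (u - z). *)
pose rem n u := d ^+ n * (u - z)^-1 ^+ n * (u - z')^-1.
have arem n : tame_on (rem n).
  by apply: bounded_measurableM => //; apply: bounded_measurableZ;
    exact: bounded_measurableX.
have step n : cint (rem n) =
    d ^+ n * cint (fun u => (u - z)^-1 ^+ n.+1) + cint (rem n.+1).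
  rewrite -contour_intZ -?contour_intD //; last 2 first.
  - by apply: bounded_measurableZ; exact: bounded_measurableX.
  - exact: bounded_measurableX.
  apply: eq_contour_int => u /nz /andP[uz uz'].
  rewrite /rem; have E : (u - z')^-1 = (u - z)^-1 + d * (u - z)^-1 * (u - z')^-1.
    by rewrite /d; field; rewrite uz uz'.
  rewrite {1}E.
  by rewrite !exprS; move: ((u - z)^-1) ((u - z')^-1) => a b; ring.
have rem1 n : cauchy_transform z' = cauchy_transform z + cint (rem n.+1).
  elim: n => [|n ->].
    have := step 0%N; rewrite expr0 mul1r /cauchy_transform => <-.
    by congr contour_int; apply/funext => u; rewrite /rem !expr0 !mul1r.
  by rewrite (step n.+1) contour_int_expV // mulr0 add0r.
apply/eqP; rewrite -subr_eq0 -normc_eq0; apply/eqP.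
have [V V0 bV] := normc_contour_int.
(* On the curve |d / (u - z)| is at most 1/2 and |1 / (u - z')| at most 2 / e; [V] plays the role of
   the length. *)
apply: (@geometric_bound_eq0 _ (2^-1 * (2 / e) * V) 2^-1); rewrite ?normc_ge0 //; first by lra.
move=> n; rewrite (rem1 n) addrAC subrr add0r.
have -> : 2^-1 * (2 / e) * V * 2^-1 ^+ n = (2^-1 ^+ n.+1 * (2 / e)) * V.
  by rewrite exprS; ring.
apply: bV => // t; rewrite /rem -exprMn !normcM normcX.
apply: ler_pM; rewrite ?normc_ge0 ?exprn_ge0 ?normc_ge0 //.
  apply: lerXn2r; rewrite ?nnegrE ?normc_ge0 ?invr_ge0 //.
  rewrite normcM normcV ler_pdivrMr; last exact: lt_le_trans (ez t).
  have := ez t; lra.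
rewrite normcV -[2 / e]invrK lef_pV2 ?posrE ?invr_gt0 ?divr_gt0 //; last first.
  by apply: lt_le_trans (z'e t); rewrite divr_gt0.
by rewrite invf_div.
Qed.

(** Expanding in powers of u / z produces only monomials in u, which integrate to 0, and a remainder
    of order (M / |z|)^n with M the largest modulus on the curve. *)
Lemma cauchy_transform_far z :
  (forall t, normc (point t) < normc z) -> cauchy_transform z = 0.
Proof.
move=> Pz.
have [c _ cmax] := @EVT_max _ (fun t => normc (point t)) 0 1 ler01
  (continuous_subspaceT (fun t => continuous_normc (Ccontinuous_point pg t))).
have {}cmax t : normc (point t) <= normc (point c).
  have := cmax _ (clamp_in t ler01).
  by rewrite /point (clamp_id (clamp_in t ler01)).
set M := normc (point c) in cmax; have Mz : M < normc z := Pz c.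
have z0 : 0 < normc z by apply: le_lt_trans Mz; exact: normc_ge0.
have z_neq0 : z != 0 by rewrite -normc_gt0.
have zM : 0 < normc z - M by rewrite subr_gt0.
have ze t : normc z - M <= normc (point t - z).
  have -> : normc (point t - z) = normc (z - point t) by rewrite -normcN opprB.
  have := cmax t; have := normcB_ge z (point t); lra.
have zC : ~ curve_image g z.
  by move=> /curve_imageP[t zt]; have := Pz t; rewrite zt ltxx.
have az := tameV zC.
pose rem n u := (u / z) ^+ n * (u - z)^-1.
have aX n : tame_on (fun u => u ^+ n).
  exact/bounded_measurableX/tame_id.
have arem n : tame_on (rem n).
  apply: bounded_measurableM => //; apply: bounded_measurableX.
  by apply: bounded_measurableM; [exact: tame_id | exact: tame_cst].
have step n : cint (rem n) = cint (rem n.+1).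
  transitivity (- (z ^- n.+1) * cint (fun u => u ^+ n) + cint (rem n.+1)).
    rewrite -contour_intZ; last exact: aX.
    rewrite -contour_intD; [|apply: bounded_measurableZ; exact: aX|exact: arem].
    apply: eq_contour_int => u uC.
    have uz : u - z != 0 by rewrite subr_eq0; apply/eqP => E; apply: zC; rewrite -E.
    rewrite /rem !expr_div_n !exprS.
    have zn : z ^+ n != 0 by rewrite expf_neq0.
    by move: (u ^+ n) (z ^+ n) zn => a b zn; field; rewrite uz z_neq0 zn.
  by rewrite contour_int_exp // mulr0 add0r.
have rem0 n : cauchy_transform z = cint (rem n).
  elim: n => [|n ->]; last exact: step.
  by congr contour_int; apply/funext => u; rewrite /rem expr0 mul1r.
apply/eqP; rewrite -normc_eq0; apply/eqP.
have [V V0 bV] := normc_contour_int.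
apply: (@geometric_bound_eq0 _ ((normc z - M)^-1 * V) (M / normc z)).
- exact: normc_ge0.
- by rewrite divr_ge0 ?normc_ge0.
- by rewrite ltr_pdivrMr // mul1r.
move=> n; rewrite (rem0 n) mulrC mulrA; apply: bV => // t.
rewrite /rem normcM normcX; apply: ler_pM; rewrite ?exprn_ge0 ?normc_ge0 //.
  apply: lerXn2r; rewrite ?nnegrE ?normc_ge0 ?divr_ge0 ?normc_ge0 //.
  by rewrite normcM normcV ler_pM2r ?invr_gt0.
by rewrite normcV lef_pV2 ?posrE // (lt_le_trans zM).
Qed.

(** Local constancy, in a form that applies to a level set and to its complement alike, as the
    connectedness argument requires. *)
Lemma open_cauchy_transform (P : R[i] -> Prop) :
  open ([set z | ~ curve_image g z /\ P (cauchy_transform z)] : set R[i]^o).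
Proof.
rewrite openE => z [zC Pz]; have [e e0 ez] := curve_dist zC.
rewrite /interior; apply/nbhs_ballP; exists (e / 2)%:C.
  by rewrite /= ltcR divr_gt0.
move=> z' /=; rewrite /ball /= => zz'.
have {}zz' : normc (z' - z) < e / 2 by rewrite -normcN opprB -ltcR.
split; last by rewrite (cauchy_transform_near e0 ez zz').
move=> /curve_imageP[t zt]; have := ez t; rewrite -zt.
by have := e0; lra.
Qed.

Lemma cauchy_transform_connected (A : set R[i]^o) z z' : connected A ->
  (forall w, A w -> ~ curve_image g w) -> A z -> A z' ->
  cauchy_transform z' = cauchy_transform z.
Proof.
move=> cA AC Az Az'.
pose B : set R[i]^o := A `&` [set w | cauchy_transform w = cauchy_transform z].
suff BA : B = A by move: Az'; rewrite -BA => -[].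
apply: cA.
- by exists z.
- exists [set w | ~ curve_image g w /\ cauchy_transform w = cauchy_transform z].
    exact: (@open_cauchy_transform (fun c => c = cauchy_transform z)).
  by apply/seteqP; split => w [Aw]; [move=> ?; do !split=> //; exact: AC | case].
- exists (~` [set w | ~ curve_image g w /\ cauchy_transform w <> cauchy_transform z]).
    apply: open_closedC.
    exact: (@open_cauchy_transform (fun c => c <> cauchy_transform z)).
  apply/seteqP; split => w [Aw]; first by move=> e; split=> // -[].
  move=> nw; split=> //; apply: contrapT => e; apply: nw; split=> //.
  exact: AC.
Qed.

(** An unbounded component contains a point of larger modulus than the whole curve, where
    [cauchy_transform_far] applies. *)
Lemma outside_cauchy_transform z : outside g z -> cauchy_transform z = 0.
Proof.
move=> [zC unb].
have [_ _ [M PM]] := bounded_measurable_point pg.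
have [z' [cz' Mz']] : exists z', compl_component g z z' /\ M < normc z'.
  apply: contrapT => nz'; apply: unb; exists M%:C; split.
    by apply/complex_realP; exists M.
  move=> y My w cw /=; apply/ltW; apply: le_lt_trans My.
  rewrite -[`|w|]/((normc w)%:C) lecR leNgt; apply/negP => Mw.
  by apply: nz'; exists w.
rewrite -(@cauchy_transform_far z') => [|t]; last exact: le_lt_trans (PM t) Mz'.
apply/esym/(@cauchy_transform_connected (compl_component g z)) => //.
- exact: component_connected.
- by move=> w /connected_component_sub.
- exact: connected_component_refl.
Qed.

Lemma Ccontinuous_continuous (f : R -> R[i]) :
  (forall t, Ccontinuous_at f t) -> continuous (f : R -> R[i]^o).
Proof.
move=> cf t; apply/cvgrPdist_lt => e e0.
have ee : e = (complex.Re e)%:C by rewrite RRe_real // ger0_real // ltW.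
have e0' : 0 < complex.Re e by rewrite -ltcR -ee.
have : {for t, continuous (fun u => normc (f u - f t))}.
  by apply: continuous_normc; apply: CcontinuousD => //; exact: Ccontinuous_cst.
move=> /cvgrPdist_lt /(_ _ e0'); apply: filterS => u.
rewrite subrr normc0 sub0r normrN ger0_norm ?normc_ge0 // => h.
by rewrite distrC ee -[`|_|]/((normc _)%:C) ltcR.
Qed.

Lemma cauchy_transform_scaled (q : R[i]) t : q != 0 -> normc q < 1 ->
  ~ curve_image g 0 -> (forall t, ~ curve_image g (point t / q)) ->
  cauchy_transform (point t / q) = 0.
Proof.
move=> q0 q1 C0 Cq.
have [c _ cmax] := @EVT_max _ (fun t => normc (point t)) 0 1 ler01
  (continuous_subspaceT (fun t => continuous_normc (Ccontinuous_point pg t))).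
have {}cmax u : normc (point u) <= normc (point c).
  have := cmax _ (clamp_in u ler01).
  by rewrite /point (clamp_id (clamp_in u ler01)).
have c0 : 0 < normc (point c).
  by rewrite normc_gt0; apply/eqP => c0; apply: C0; rewrite -c0; exact: point_on_curve.
have qp : 0 < normc q by rewrite normc_gt0.
rewrite -(@cauchy_transform_far (point c / q)) => [|u]; last first.
  rewrite normcM normcV ltr_pdivlMr //.
  by apply: le_lt_trans (ler_wpM2r _ (cmax u)) _; rewrite ?normc_ge0 // gtr_pMr.
pose f u : R[i]^o := point u / q.
have cf : continuous f.
  apply: Ccontinuous_continuous => u; apply: CcontinuousM.
    exact: Ccontinuous_point.
  exact: Ccontinuous_cst.
apply: (@cauchy_transform_connected (range f)).
- apply: connected_continuous_connected; last exact: continuous_subspaceT.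
  by apply/connected_intervalP => ? ? _ _ ? _.
- by move=> _ [u _ <-]; exact: Cq.
- by exists c.
- by exists t.
Qed.

End Winding.

(** * Residue calculus by partial fractions *)

Section RationalContourIntegrals.
Context {R : realType}.
Variable g : R -> R[i].
Hypothesis pg : piecewise_C1 g.
Hypothesis g01 : g 0 = g 1.

Local Notation cint := (contour_int g).
Local Notation tame_on := (tame (point g)).

(** With c equal to [two_pi_i] for poles inside and to 0 for poles outside, both cases share the
    same lemmas. *)
Definition winds (c z : R[i]) : Prop :=
  ~ curve_image g z /\ cauchy_transform g z = c.

Definition den (zs : seq R[i]) u := \prod_(z <- zs) (u - z).

Lemma den_neq0 zs u : (forall z, z \in zs -> ~ curve_image g z) ->
  curve_image g u -> den zs u != 0.
Proof.
move=> zsC uC; rewrite /den prodf_seq_neq0; apply/allP => z zzs /=.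
by rewrite subr_eq0; apply/eqP => uz; apply: (zsC z zzs); rewrite -uz.
Qed.

Lemma tame_denV zs : (forall z, z \in zs -> ~ curve_image g z) ->
  tame_on (fun u => (den zs u)^-1).
Proof.
elim: zs => [|z zs IH] zsC.
  by rewrite /den; under eq_fun do rewrite big_nil; exact: tame_cst.
rewrite /tame /den; under eq_fun do rewrite big_cons invfM.
apply: bounded_measurableM; first exact: (tameV pg (zsC z (mem_head _ _))).
by apply: IH => w wzs; apply: zsC; rewrite in_cons wzs orbT.
Qed.

Lemma tame_horner (p : {poly R[i]}) : tame_on (fun u => p.[u]).
Proof.
elim/poly_ind: p => [|p c IH].
  have := tame_cst g 0; congr bounded_measurable.
  by apply/funext => t; rewrite horner0.
rewrite /tame; under eq_fun do rewrite hornerMXaddC.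
apply: bounded_measurableD; last exact: tame_cst.
by apply: bounded_measurableM => //; exact: tame_id.
Qed.

(** Two distinct poles z0 and z1 are separated by partial fractions; the two resulting integrals
    cancel, being both c if no other pole is left and both 0 by induction otherwise. If all poles
    coincide, a power of order at least 2 has a primitive, and a simple pole is allowed only for c =
    0. *)
Lemma contour_int_inv_den c zs : (forall z, z \in zs -> winds c z) ->
  (1 < size zs)%N \/ (c = 0 /\ (0 < size zs)%N) ->
  cint (fun u => (den zs u)^-1) = 0.
Proof.
case: zs => [|z0 zs]; first by move=> _ [|[]].
have [n] := ubnP (size zs); elim: n z0 zs => // n IH z0 zs.
rewrite ltnS => szs zsc cs.
have zsC z : z \in z0 :: zs -> ~ curve_image g z by move=> /zsc[].
have [z0C z0c] := zsc z0 (mem_head _ _).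
have [/all_pred1P zsE|/allPn[z1 z1zs /= z10]] := boolP (all (pred1 z0) zs).
  have -> : (fun u => (den (z0 :: zs) u)^-1) =
      (fun u => (u - z0)^-1 ^+ (size zs).+1).
    apply/funext => u; rewrite /den big_cons zsE big_nseq size_nseq.
    by rewrite iter_mulr_1 -exprS exprVn.
  rewrite /= in cs; case: (size zs) cs => [|k] cs; last exact: contour_int_expV.
  case: cs => // -[c0 _]; rewrite c0 in z0c.
  by rewrite -[RHS]z0c; congr contour_int; apply/funext => u; rewrite expr1.
pose zs' := rem z1 zs; have zsE : perm_eq zs (z1 :: zs') := perm_to_rem z1zs.
have denE z : den (z :: zs) =1 den (z :: z1 :: zs').
  by move=> u; rewrite /den; apply: perm_big; rewrite perm_cons.
have zs'zs z : z \in zs' -> z \in zs by exact: mem_rem.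
have ad i : i = z0 \/ i = z1 -> tame_on (fun u => (den (i :: zs') u)^-1).
  move=> i01; apply: tame_denV => z; rewrite in_cons => /orP[/eqP ->|/zs'zs zzs].
    by case: i01 => ->; apply: zsC; rewrite ?mem_head // in_cons z1zs orbT.
  by apply: zsC; rewrite in_cons zzs orbT.
have sz : size zs = (size zs').+1 by rewrite (perm_size zsE).
have same : cint (fun u => (den (z0 :: zs') u)^-1) =
    cint (fun u => (den (z1 :: zs') u)^-1).
  have [zs'0|zs'N] := posnP (size zs').
    have -> : zs' = [::] by apply: size0nil.
    transitivity c; [rewrite -{}z0c|].
      by congr contour_int; apply/funext => u; rewrite /den big_seq1.
    have [_ <-] : winds c z1 by apply: zsc; rewrite in_cons z1zs orbT.
    by congr contour_int; apply/funext => u; rewrite /den big_seq1.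
  rewrite sz in szs.
  rewrite (IH z0) //.
  - rewrite (IH z1) // => [z|]; last by left.
    by rewrite in_cons => /orP[/eqP ->|/zs'zs zzs]; apply: zsc;
      rewrite in_cons ?z1zs ?zzs ?orbT.
  - move=> z; rewrite in_cons => /orP[/eqP ->|/zs'zs zzs]; first exact/zsc/mem_head.
    by apply: zsc; rewrite in_cons zzs orbT.
  - by left.
transitivity (cint (fun u => (z0 - z1)^-1 *
    ((den (z0 :: zs') u)^-1 + -1 * (den (z1 :: zs') u)^-1))).
  apply: eq_contour_int => u uC; rewrite denE /den !big_cons.
  have D0 : \prod_(z <- zs') (u - z) != 0.
    by apply: (den_neq0 _ uC) => z /zs'zs zzs; apply: zsC; rewrite in_cons zzs orbT.
  have uz z : ~ curve_image g z -> u - z != 0.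
    by move=> zC; rewrite subr_eq0; apply/eqP => E; apply: zC; rewrite -E.
  have u0 := uz _ z0C.
  have u1 : u - z1 != 0 by apply: uz; apply: zsC; rewrite in_cons z1zs orbT.
  have z01 : z0 - z1 != 0 by rewrite subr_eq0 eq_sym.
  by move: (\prod_(z <- zs') (u - z)) D0 => D D0; field; rewrite u0 u1 z01 D0.
rewrite (contour_intZ pg); last first.
  apply: bounded_measurableD; first by apply: ad; left.
  by apply: bounded_measurableZ; apply: ad; right.
rewrite (contour_intD pg); last 2 first.
- by apply: ad; left.
- by apply: bounded_measurableZ; apply: ad; right.
by rewrite (contour_intZ pg) ?same ?mulN1r ?subrr ?mulr0 //; apply: ad; right.
Qed.

Lemma contour_int_horner (p : {poly R[i]}) : cint (fun u => p.[u]) = 0.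
Proof.
have -> : (fun u => p.[u]) = (fun u => \sum_(i < size p) p`_i * u ^+ i).
  by apply/funext => u; exact: horner_coef.
have aX n : tame_on (fun u => u ^+ n).
  exact/bounded_measurableX/tame_id.
suff [//] : cint (fun u => \sum_(i < size p) p`_i * u ^+ i) = 0 /\
    tame_on (fun u => \sum_(i < size p) p`_i * u ^+ i).
elim: (size p) => [|n [IH aIH]].
  under eq_fun do rewrite big_ord0; split; first exact: contour_int0.
  exact: tame_cst.
have aZ : tame_on (fun u => p`_n * u ^+ n) by apply: bounded_measurableZ; exact: aX.
split; last first.
  rewrite /tame; under eq_fun do rewrite big_ord_recr /=.
  exact: bounded_measurableD.
under eq_fun do rewrite big_ord_recr /=.
by rewrite (contour_intD pg) // IH (contour_intZ pg) // contour_int_exp // mulr0 addr0.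
Qed.

(* Sum of residues: either all poles are outside the contour, or all are inside
   and the integrand is O(u^-2) at infinity. *)
Lemma contour_int_rational c zs (p : {poly R[i]}) :
  (forall z, z \in zs -> winds c z) -> (size p < size zs)%N \/ c = 0 ->
  cint (fun u => p.[u] / den zs u) = 0.
Proof.
elim: zs p => [|z zs IH] p zsc pc.
  rewrite -[RHS](contour_int_horner p); congr contour_int; apply/funext => u.
  by rewrite /den big_nil divr1.
have [->|p0] := eqVneq p 0.
  under eq_fun do rewrite horner0 mul0r; exact: contour_int0.
have sp : (0 < size p)%N by rewrite size_poly_gt0.
have zsC w : w \in z :: zs -> ~ curve_image g w by move=> /zsc[].
have zsC' w : w \in zs -> ~ curve_image g w.
  by move=> wzs; apply: zsC; rewrite in_cons wzs orbT.
(* Dividing by X - z splits the quotient into one with pole z removed and a constant over the full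
   denominator; the gap between the two sizes is preserved. *)
pose p1 := p %/ ('X - z%:P).
have pE : p = p1 * ('X - z%:P) + (p.[z])%:P by rewrite -modp_XsubC -divp_eq.
have sp1 : size p1 = (size p).-1.
  by rewrite size_divp ?polyXsubC_eq0 // size_XsubC subn1.
transitivity (cint (fun u => p1.[u] / den zs u + p.[z] * (den (z :: zs) u)^-1)).
  apply: eq_contour_int => u uC; rewrite {1}pE /den big_cons !hornerE.
  have uz : u - z != 0.
    rewrite subr_eq0; apply/eqP => E; apply: (zsC z); first exact: mem_head.
    by rewrite -E.
  have := den_neq0 zsC' uC; rewrite /den.
  by move: (\prod_(w <- zs) (u - w)) => D D0; field; rewrite uz D0.
have a1 : tame_on (fun u => p1.[u] / den zs u).
  by apply: bounded_measurableM; [exact: tame_horner | exact: tame_denV].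
have a2 := tame_denV zsC.
rewrite (contour_intD pg) //; last exact: bounded_measurableZ.
rewrite IH ?add0r; last 2 first.
- by move=> w wzs; apply: zsc; rewrite in_cons wzs orbT.
- case: pc => [h|->]; last by right.
  by left; rewrite sp1; case: (size p) sp h.
rewrite (contour_intZ pg) // (contour_int_inv_den zsc) ?mulr0 //.
by case: pc => [h|->]; [left; exact: leq_ltn_trans sp h | right].
Qed.

(** Subtracting from p the multiple of the denominator that agrees with it at 0 removes the pole at
    0: what is left has poles outside only, plus a multiple of 1 / u. *)
Lemma cauchy_formula0 zs (p : {poly R[i]}) :
  (forall z, z \in zs -> winds 0 z) -> winds (two_pi_i R) 0 ->
  cint (fun u => u^-1 * (p.[u] / den zs u)) = two_pi_i R * (p.[0] / den zs 0).
Proof.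
move=> zs0 [C0 W0].
have zsC w : w \in zs -> ~ curve_image g w by move=> /zs0[].
(* If 0 were in [zs], its Cauchy transform would be both 0 and [two_pi_i]. *)
have D00 : den zs 0 != 0.
  rewrite /den prodf_seq_neq0; apply/allP => z /zs0[_ z0] /=; rewrite sub0r oppr_eq0.
  apply: contra_eq_neq z0 => ->; rewrite W0; exact: two_pi_i_neq0.
pose D := \prod_(z <- zs) ('X - z%:P).
have DE u : D.[u] = den zs u.
  by rewrite horner_prod /den; apply: eq_bigr => z _; rewrite hornerXsubC.
set k := p.[0] / den zs 0.
have : root (p - k *: D) 0.
  by rewrite rootE !hornerE DE /k divfK // subrr.
move=> /factor_theorem[p1 pE].
have u0 u : curve_image g u -> u != 0 by move=> uC; apply/eqP => E; apply: C0; rewrite -E.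
transitivity (cint (fun u => p1.[u] / den zs u + k * (u - 0)^-1)).
  apply: eq_contour_int => u uC; rewrite subr0.
  have -> : p.[u] = p1.[u] * u + k * den zs u.
    have := congr1 (fun r => r.[u]) pE; rewrite /= subr0 !hornerE DE.
    by move/eqP; rewrite subr_eq => /eqP.
  have := den_neq0 zsC uC; have := u0 u uC.
  by move: (den zs u) => d u0' d0; field; rewrite u0' d0.
rewrite (contour_intD pg) //; last 2 first.
- by apply: bounded_measurableM; [exact: tame_horner | exact: tame_denV].
- by apply: bounded_measurableZ; exact: tameV.
rewrite (contour_int_rational zs0) ?add0r; last by right.
by rewrite (contour_intZ pg); [rewrite -/(cauchy_transform g 0) W0 mulrC | exact: tameV].
Qed.

End RationalContourIntegrals.

(** * Path configurations *)

Section PathConfigurations.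
Context {R : realType}.
Variables q s : R[i].
Hypothesis qq0 : forall n, qpoch q q n != 0.
Hypothesis ss0 : forall n, qpoch q (s ^+ 2) n != 0.

(* A profile [b] lists the numbers of vertical paths [b_0, b_1, ..] in the
   columns 1, 2, ..; [l] lists the numbers of horizontal paths entering them. *)
Definition below_profile (b l : seq nat) : seq nat :=
  mkseq (fun c => (nth 0 b c - nth 0 l c + nth 0 l c.+1)%N) (size b).

(** By path conservation, the condition i >= l of a vertex weight reads j <= k: at most as many
    paths enter from the left as leave through the top. Hence a row has finitely many fillings. *)
Fixpoint bounded_seqs (b : seq nat) : seq (seq nat) :=
  if b is k :: b' then [seq l :: ls | l <- iota 0 k.+1, ls <- bounded_seqs b']
  else [:: [::]].

Lemma mem_bounded_seqs b l : (l \in bounded_seqs b) =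
  (size l == size b) && [forall c : 'I_(size b), (nth 0 l c <= nth 0 b c)%N].
Proof.
elim: b l => [|k b IH] l.
  by rewrite in_cons orbF /=; case: l => //=; apply/esym/forallP => -[].
apply/allpairsPdep/idP => [[x [y [xk]]]|].
  have {}xk : x \in iota 0 k.+1 := xk; rewrite mem_iota in xk.
  rewrite IH => /andP[/eqP sy /forallP yb] ->.
  rewrite /= sy eqxx /=; apply/forallP => -[[|c] ltc] //=.
  exact: (yb (Ordinal (ltc : (c < size b)%N))).
case: l => [|x l] //= /andP[sl /forallP lb]; exists x, l; split=> //.
  by rewrite -[0%N :: _]/(iota 0 k.+1) mem_iota; exact: (lb ord0).
rewrite IH -eqSS sl /=; apply/forallP => c.
exact: (lb (lift ord0 c)).
Qed.

Lemma bounded_seqsP b l : l \in bounded_seqs b ->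
  size l = size b /\ (forall c, (nth 0 l c <= nth 0 b c)%N).
Proof.
rewrite mem_bounded_seqs => /andP[/eqP sl /forallP lb]; split=> // c.
have [ltc|lec] := ltnP c (size b); first exact: (lb (Ordinal ltc)).
by rewrite !nth_default // sl.
Qed.

Lemma uniq_bounded_seqs b : uniq (bounded_seqs b).
Proof.
elim: b => [//|k b IH]; apply: (allpairs_uniq (iota_uniq 0 k.+1) IH).
by move=> [x l] [y l'] _ _ /= [-> ->].
Qed.

Lemma nth_below_profile b l c : size l = size b ->
  nth 0 (below_profile b l) c = (nth 0 b c - nth 0 l c + nth 0 l c.+1)%N.
Proof.
move=> sl; have [ltc|lec] := ltnP c (size b); first by rewrite nth_mkseq.
by rewrite !nth_default ?size_mkseq ?sl // leqW.
Qed.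

Definition add_row m (hv : hconf m * vconf m) (l b : seq nat) :
    hconf m.+1 * vconf m.+1 :=
  (fun r => if unlift ord_max r is Some r' then hv.1 r' else nth 0%N l,
   fun r => if unlift ord_max r is Some r' then hv.2 r' else nth 0%N b).

(** Rows are peeled off from the top, where the profile is prescribed: the top and horizontal edges
    of a row determine its bottom edges. *)
Fixpoint configs m (b : seq nat) : seq (hconf m * vconf m) :=
  match m with
  | 0 => if all (pred1 0%N) b then [:: (fun _ _ => 0%N, fun _ _ => 0%N)] else [::]
  | m'.+1 => [seq add_row hv l b | l <- bounded_seqs b,
                                   hv <- configs m' (below_profile b l)]
  end.

Lemma add_row_inj m hv hv' l l' b : size l = size l' ->
  @add_row m hv l b = add_row hv' l' b -> hv = hv' /\ l = l'.
Proof.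
case: hv hv' => [h v] [h' v'] sl [hh vv]; split.
  congr pair; apply/funext => r.
    by have := congr1 (fun f => f (lift ord_max r)) hh; rewrite /= liftK.
  by have := congr1 (fun f => f (lift ord_max r)) vv; rewrite /= liftK.
have := congr1 (fun f => f ord_max) hh; rewrite /= unlift_none => ll.
by apply: (@eq_from_nth _ 0%N) => // i _; rewrite ll.
Qed.

Lemma uniq_configs m b : uniq (configs m b).
Proof.
elim: m b => [|m IH] b /=; first by case: ifP.
apply: allpairs_uniq_dep => [|l _|]; [exact: uniq_bounded_seqs | exact: IH |].
move=> [l hv] [l' hv'] /allpairsPdep[l1 [hv1 [l1b _ [-> _]]]].
move=> /allpairsPdep[l2 [hv2 [l2b _ [-> _]]]] /=.
have [s1 _] := bounded_seqsP l1b; have [s2 _] := bounded_seqsP l2b.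
by move=> e; have [-> ->] := add_row_inj (etrans s1 (esym s2)) e.
Qed.

Definition top_admissible m (b : seq nat) : set (hconf m * vconf m) :=
  [set hv | [/\ forall r, \forall c \near \oo, hv.1 r c = 0%N,
                forall c, hv.2 ord0 c = 0%N
              & hv.2 ord_max = nth 0%N b]].

Lemma configs_admissible m b hv : hv \in configs m b -> top_admissible b hv.
Proof.
elim: m b hv => [|m IH] b hv /=.
  case: ifP => // /allP b0; rewrite inE => /eqP ->; split=> [[]//|//|].
  apply/funext => c; have [/(mem_nth 0%N)/b0/eqP ->//|lec] := ltnP c (size b).
  by rewrite nth_default.
move=> /allpairsPdep[l [hv' [/bounded_seqsP[sl lb] /IH[h0 v0 vb] ->]]]; split.
- move=> r; rewrite /=; case: unliftP => [r' _|_]; first exact: h0.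
  by exists (size l) => // c; exact: nth_default.
- move=> c; rewrite /= (_ : ord0 = lift ord_max ord0) ?liftK //.
  by apply: ord_inj; rewrite lift_max.
- by rewrite /= unlift_none.
Qed.

Definition row_weight x (v h k : nat -> nat) : R[i] :=
  xpoch q s x (h 0%N) / qpoch q q (h 0%N) *
  inf_prod (fun c => vweight q s x (v c) (h c) (k c) (h c.+1)).

Lemma conf_weight_add_row m (x : nat -> R[i]) hv l b :
  conf_weight q s (fun i : 'I_m.+1 => x i) (add_row hv l b) =
  conf_weight q s (fun i : 'I_m => x i) hv *
  row_weight (x m) (hv.2 ord_max) (nth 0%N l) (nth 0%N b).
Proof.
case: hv => h v; rewrite /conf_weight /add_row big_ord_recr /=; congr (_ * _).
  apply: eq_bigr => r _.
  have w1 n (i : 'I_n) : widen_ord (leqnSn n) i = lift ord_max i.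
    by apply: ord_inj; rewrite lift_max.
  have w2 : lift ord0 (widen_ord (leqnSn m) r) = lift ord_max (lift ord0 r).
    by apply: ord_inj; rewrite lift_max.
  by rewrite w2 !w1 !liftK.
have w1 : widen_ord (leqnSn m.+1) ord_max = lift ord_max ord_max.
  by apply: ord_inj; rewrite lift_max.
have w2 : lift ord0 ord_max = ord_max :> 'I_m.+2 by exact: val_inj.
by rewrite w1 w2 !unlift_none liftK.
Qed.

Lemma inf_prod_eventually1 (f : nat -> R[i]) n :
  (forall c, (n <= c)%N -> f c = 1) -> inf_prod f = \prod_(c < n) f c.
Proof.
move=> f1; apply: (@lim_near_cst R[i]^o); first exact: norm_hausdorff.
exists n => // k /= lenk.
rewrite -(subnKC lenk) -!(big_mkord xpredT) /= (@big_cat_nat _ _ _ n) ?leq_addr //=.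
rewrite [X in _ * X]big_nat_cond [X in _ * X]big1 ?mulr1 // => i /andP[/andP[ni _] _].
exact: f1.
Qed.

Lemma inf_prod_neq0 (f : nat -> R[i]) : inf_prod f != 0 -> forall c, f c != 0.
Proof.
move=> + c; apply: contra_neqN => /eqP fc.
apply: (@lim_near_cst R[i]^o); first exact: norm_hausdorff.
exists c.+1 => // k /= ltck.
by rewrite (bigD1 (Ordinal ltck)) //= fc mul0r.
Qed.

Lemma vweight_neq0 x i j k l : vweight q s x i j k l != 0 ->
  (i + j = k + l)%N /\ (j <= k)%N.
Proof.
rewrite /vweight; case: ifP => [/andP[/eqP e li] _|]; last by rewrite eqxx.
by split=> //; rewrite -(leq_add2l i) e addnC leq_add2r.
Qed.

(** A nonzero infinite product has no zero factor, so every vertex conserves paths and satisfies h_c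
    <= b_c. In particular no horizontal path lives beyond the support of [b], and the row is one of
    the listed ones. *)
Lemma configs_complete m b (x : nat -> R[i]) hv : top_admissible b hv ->
  conf_weight q s (fun i : 'I_m => x i) hv != 0 -> hv \in configs m b.
Proof.
elim: m b hv => [|m IH] b hv.
  move=> [h0 v0 vb] _; rewrite /= ifT.
    rewrite inE; apply/eqP; case: hv h0 v0 vb => h v /= h0 v0 vb.
    congr pair; apply/funext; first by case.
    by move=> r; apply/funext => c; rewrite (ord1 r).
  apply/allP => k /(nthP 0%N)[c _ <-] /=; rewrite -vb.
  by rewrite (_ : ord_max = ord0) ?v0 //; exact: val_inj.
case: hv => hh vv [/= h0 v0 vb] w0.
pose l := mkseq (hh ord_max) (size b).
pose hv' : hconf m * vconf m :=
  (fun r => hh (lift ord_max r), fun r => vv (lift ord_max r)).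
pose kk := nth 0%N b; pose h := hh ord_max; pose v := hv'.2 ord_max.
have rw : row_weight (x m) v h kk != 0 /\
    conf_weight q s (fun i : 'I_m => x i) hv' != 0.
  move: w0; rewrite {1}/conf_weight big_ord_recr /= mulf_eq0 negb_or => /andP[w1 w2]; split.
    move: w2; rewrite /row_weight /kk -vb /=.
    have -> : widen_ord (leqnSn m.+1) ord_max = lift ord_max ord_max.
      by apply: ord_inj; rewrite lift_max.
    by have -> : lift ord0 ord_max = ord_max :> 'I_m.+2 by exact: val_inj.
  apply: contraNneq w1 => <-; apply/eqP; rewrite /conf_weight /=.
  apply: eq_bigr => r _.
  have w1 n (i : 'I_n) : widen_ord (leqnSn n) i = lift ord_max i.
    by apply: ord_inj; rewrite lift_max.
  have w2' : lift ord0 (widen_ord (leqnSn m) r) = lift ord_max (lift ord0 r).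
    by apply: ord_inj; rewrite lift_max.
  by rewrite w2' !w1.
case: rw => rw wh.
have cons c : (v c + h c = kk c + h c.+1)%N /\ (h c <= kk c)%N.
  move: rw; rewrite /row_weight mulf_eq0 negb_or => /andP[_].
  by move=> /inf_prod_neq0/(_ c)/vweight_neq0.
have hE : h = nth 0%N l.
  apply/funext => c; have [ltc|lec] := ltnP c (size b); first by rewrite nth_mkseq.
  rewrite nth_default ?size_mkseq //; apply/eqP; rewrite -leqn0.
  by have [_] := cons c; rewrite /kk nth_default.
have lb : l \in bounded_seqs b.
  rewrite mem_bounded_seqs size_mkseq eqxx; apply/forallP => c.
  by rewrite -hE; have [_] := cons c.
have vE : v = nth 0%N (below_profile b l).
  apply/funext => c; rewrite nth_below_profile ?size_mkseq // -hE.
  have [e le] := cons c; apply/eqP; rewrite -(eqn_add2r (h c)) e.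
  by rewrite addnAC subnK.
have -> : (hh, vv) = add_row hv' l b.
  congr pair; apply/funext => r /=.
    by case: unliftP => [r'|] ->.
  by case: unliftP => [r'|] ->.
apply/allpairsPdep; exists l, hv'; split=> //.
apply: IH => //; split=> //.
- by move=> r; exact: h0.
- move=> c; rewrite /= (_ : lift ord_max ord0 = ord0) //.
  by apply: ord_inj; rewrite lift_max.
Qed.

Fixpoint branching m (x : nat -> R[i]) (b : seq nat) : R[i] :=
  match m with
  | 0 => (all (pred1 0%N) b)%:R
  | m'.+1 => \sum_(l <- bounded_seqs b)
      (\prod_(c < size b) block_coef q s (x m') (nth 0%N b c) (nth 0%N l c)) *
      branching m' x (below_profile b l)
  end.

(** A vertex weight splits into a factor [A] of its right edge and a factor [B] of its column.
    Charging each [A] to the next column also absorbs the boundary factor of column 0. *)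
Lemma row_weightE x b l : l \in bounded_seqs b ->
  row_weight x (nth 0%N (below_profile b l)) (nth 0%N l) (nth 0%N b) =
  \prod_(c < size b) block_coef q s x (nth 0%N b c) (nth 0%N l c).
Proof.
move=> /bounded_seqsP[sl lb].
pose A c := xpoch q s x (nth 0%N l c) / qpoch q q (nth 0%N l c).
pose B c := qpoch q (- s * x) (nth 0 b c - nth 0 l c)%N * qpoch q q (nth 0%N b c) /
  (qpoch q q (nth 0 b c - nth 0 l c)%N * qpoch q (s ^+ 2) (nth 0%N b c)).
have vE c : vweight q s x (nth 0%N (below_profile b l) c) (nth 0%N l c)
    (nth 0%N b c) (nth 0%N l c.+1) = A c.+1 * B c.
  rewrite /vweight nth_below_profile // addnAC subnK // eqxx leq_addl /= addnK.
  rewrite /A /B; field.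
  by rewrite !qq0 ss0.
have A1 c : (size b <= c)%N -> A c = 1.
  move=> lec; rewrite /A nth_default ?sl // /xpoch /qpoch !big_ord0.
  by rewrite divr1.
have B1 c : (size b <= c)%N -> B c = 1.
  move=> lec; rewrite /B !nth_default ?sl // /qpoch !big_ord0.
  by rewrite mulr1 divr1.
rewrite /row_weight (@inf_prod_eventually1 _ (size b)); last first.
  by move=> c lec; rewrite vE A1 ?B1 ?mulr1 // leqW.
rewrite -/(A 0%N); under eq_bigr do rewrite vE.
transitivity (\prod_(c < size b) (A c * B c)).
  rewrite [in LHS]big_split [in RHS]big_split /= mulrA; congr (_ * _).
  transitivity (\prod_(c < (size b).+1) A c); first by rewrite [RHS]big_ord_recl.
  by rewrite big_ord_recr /= A1 // mulr1.
apply: eq_bigr => c _; rewrite /A /B.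
move: (nth 0%N b c) (nth 0%N l c) (lb c) => k j lejk.
have E : qbinom q k j * qpoch q q j * qpoch q q (k - j) = qpoch q q k :=
  qbinom_qpochhammer q lejk.
have -> : block_coef q s x k j = qbinom q k j * xpoch q s x j *
  qpoch q (- s * x) (k - j) / qpoch q (s ^+ 2) k by [].
by rewrite -E; field; rewrite !qq0 ss0.
Qed.

Lemma sum_configs m (x : nat -> R[i]) b :
  \sum_(hv <- configs m b) conf_weight q s (fun i : 'I_m => x i) hv =
  branching m x b.
Proof.
elim: m b => [|m IH] b /=.
  case: ifP => _; last by rewrite big_nil.
  by rewrite big_seq1 /conf_weight big_ord0.
rewrite big_allpairs_dep [LHS]big_seq [RHS]big_seq; apply: eq_bigr => l lb.
rewrite -IH mulr_sumr [LHS]big_seq [RHS]big_seq; apply: eq_bigr => hv hvc.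
have [_ _ vb] := configs_admissible hvc.
by rewrite conf_weight_add_row vb row_weightE // mulrC.
Qed.

Definition profile (la : seq nat) : seq nat :=
  mkseq (fun c => (nth 0 la c - nth 0 la c.+1)%N) (size la).

Lemma spin_qWhittaker_branching m la (x : nat -> R[i]) :
  spin_qWhittaker q s la (fun i : 'I_m => x i) = branching m x (profile la).
Proof.
have admE : @admissible m la = top_admissible (profile la).
  apply/seteqP; split => hv [h0 v0 vb]; split=> //.
    apply/funext => c; rewrite vb; have [ltc|lec] := ltnP c (size la).
      by rewrite nth_mkseq.
    by rewrite !nth_default ?size_mkseq // leqW.
  move=> c; rewrite vb; have [ltc|lec] := ltnP c (size la).
    by rewrite nth_mkseq.
  by rewrite !nth_default ?size_mkseq // leqW.
rewrite /spin_qWhittaker admE -sum_configs (fsbig_seq _ _ (uniq_configs _ _)).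
apply/esym/fsbig_widen.
- by move=> hv /=; exact: configs_admissible.
- move=> hv [adm /negP nin] /=; apply/eqP; apply: contraNT nin.
  exact: configs_complete.
Qed.

End PathConfigurations.

(** * The integral representation *)

Section IntegralRepresentation.
Context {R : realType}.
Variables (q s : R[i]) (x : nat -> R[i]) (g : R -> R[i]).
Hypothesis hq : `|q| < 1.
Hypothesis hs : `|s| < 1.
Hypothesis hg : pos_closed_contour g.
Hypothesis hsV : s != 0 -> outside g s^-1.
Hypothesis h0 : inside g 0.
Hypothesis hsq : forall i : nat, inside g (s * q ^+ i).
Hypothesis hqC : forall z, curve_image g z -> inside g (q * z).

Local Notation C := (curve_image g).
Local Notation P := (point g).
Local Notation tame_on := (tame P).
Local Notation cint := (contour_int g).
Local Notation kern := (kernel q).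
Local Notation nest := (nested q g).

Let pg : piecewise_C1 g. Proof. by case: hg. Qed.
Let g01 : g 0 = g 1. Proof. by case: hg. Qed.

(** * Nonvanishing denominators and position of the poles *)

Lemma qpoch_neq0 (a : R[i]) n : normc a < 1 -> qpoch q a n != 0.
Proof.
move=> a1; rewrite /qpoch prodf_seq_neq0; apply/allP => i _ /=.
rewrite subr_eq0; apply/eqP => /(congr1 (@normc R)).
rewrite normc1 normcM normcX => e.
have q1 : normc q < 1 by rewrite -ltcR.
have : normc a * normc q ^+ i < 1.
  apply: le_lt_trans a1; rewrite -[leRHS]mulr1 ler_wpM2l ?normc_ge0 //.
  by rewrite exprn_ile1 ?normc_ge0 // ltW.
by rewrite -e ltxx.
Qed.

Lemma qq_neq0 n : qpoch q q n != 0.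
Proof. by apply: qpoch_neq0; rewrite -ltcR. Qed.

Lemma ss_neq0 n : qpoch q (s ^+ 2) n != 0.
Proof.
have s1 : normc s < 1 by rewrite -ltcR.
apply: qpoch_neq0; rewrite normcX expr2.
by apply: le_lt_trans s1; rewrite -[leRHS]mulr1 ler_wpM2l ?normc_ge0 // ltW // -ltcR.
Qed.

Lemma inside_winds z : inside g z -> winds g (two_pi_i R) z.
Proof.
move=> iz; split; first by case: iz.
have [_ _ _ /(_ z iz)] := hg; rewrite /winding => W.
by rewrite -[RHS]mulr1 -W mulVKf // two_pi_i_neq0.
Qed.

Lemma winds0 : winds g (two_pi_i R) 0.
Proof. exact: inside_winds. Qed.

Lemma winds_s : winds g (two_pi_i R) s.
Proof. by have := inside_winds (hsq 0); rewrite mulr1. Qed.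

Lemma winds_qC z : C z -> winds g (two_pi_i R) (q * z).
Proof. by move=> /hqC/inside_winds. Qed.

Lemma winds_sV : s != 0 -> winds g 0 s^-1.
Proof.
move=> /hsV o; split; first by case: o.
exact: outside_cauchy_transform.
Qed.

Lemma curve_neq0 z : C z -> z != 0.
Proof. by move=> zC; apply/eqP => E; case: winds0 => + _; apply; rewrite -E. Qed.

Lemma curve_neq_s z : C z -> z - s != 0.
Proof.
by move=> zC; rewrite subr_eq0; apply/eqP => E; case: winds_s => + _; apply; rewrite -E.
Qed.

Lemma curve_neq_sV z : C z -> 1 - s * z != 0.
Proof.
move=> zC; rewrite subr_eq0; have [->|s0] := eqVneq s 0; first by rewrite mul0r oner_eq0.
apply/eqP => E; have [+ _] := winds_sV s0; apply.
by rewrite -[s^-1]mulr1 E mulKf.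
Qed.

Lemma curve_neq_q z w : C z -> C w -> z - q * w != 0.
Proof.
move=> zC wC; rewrite subr_eq0; apply/eqP => E.
by have [+ _] := winds_qC wC; apply; rewrite -E.
Qed.

(* The point of [g] of largest modulus is mapped by [1/q] to the unbounded
   component, and [g/q] does not meet the contour. *)
Lemma winds_Cq t : q != 0 -> winds g 0 (P t / q).
Proof.
move=> q0.
(* Otherwise q times this point, which is on the contour, would be inside it. *)
have nC u : ~ C (P u / q).
  move=> /[dup] c /hqC; rewrite mulrC divfK // => -[+ _]; apply.
  exact: point_on_curve.
split=> //; apply: cauchy_transform_scaled => //; first by rewrite -ltcR.
by case: winds0.
Qed.

Lemma tame_continuous (f : R[i] -> R[i]) :
  (forall t, Ccontinuous_at (fun t => f (P t)) t) -> tame_on f.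
Proof. exact: bounded_measurable_comp_point. Qed.

Let cP t : Ccontinuous_at P t. Proof. exact: Ccontinuous_point. Qed.

Lemma Ccontinuous_linear (a b : R[i]) t : Ccontinuous_at (fun t => a + b * P t) t.
Proof.
apply: CcontinuousD; first exact: Ccontinuous_cst.
by apply: CcontinuousM => //; exact: Ccontinuous_cst.
Qed.

Lemma Ccontinuous_linearV (a b : R[i]) t : (forall z, C z -> a + b * z != 0) ->
  Ccontinuous_at (fun t => (a + b * P t)^-1) t.
Proof.
move=> ab; apply: CcontinuousV; last exact: Ccontinuous_linear.
exact/ab/point_on_curve.
Qed.

Definition integrand m n (u : R[i]) : R[i] :=
  ((1 - s * u) / (u - s)) ^+ n *
  (\prod_(j < m) (1 + u * x j) / (1 - s * u) ^+ m.+1).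

Lemma tame_linear (a b : R[i]) : tame_on (fun u => a + b * u).
Proof. by apply: tame_continuous => t; exact: Ccontinuous_linear. Qed.

Lemma tame_sV : tame_on (fun u => (1 - s * u)^-1).
Proof.
apply: tame_continuous => t.
have := @Ccontinuous_linearV 1 (- s) t; under eq_fun do rewrite mulNr; apply.
by move=> z /curve_neq_sV; rewrite mulNr.
Qed.

Lemma tame_integrand m n : tame_on (integrand m n).
Proof.
have t1 : tame_on (fun u => 1 - s * u).
  by have := tame_linear 1 (- s); congr bounded_measurable; apply/funext => t; rewrite mulNr.
apply: bounded_measurableM.
  apply: bounded_measurableX; apply: bounded_measurableM => //.
  by apply: tameV => //; case: winds_s.
apply: bounded_measurableM.
  apply: bounded_measurable_prod => j.
  by have := tame_linear 1 (x j); congr bounded_measurable; apply/funext => t; rewrite mulrC.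
have := bounded_measurableX m.+1 tame_sV; congr bounded_measurable.
by apply/funext => t; rewrite exprVn.
Qed.

Lemma kernel_gap : exists2 e : R, 0 < e & forall t u, e <= normc (P t - q * P u).
Proof.
pose D (p : R * R) := normc (P p.1 - q * P p.2).
have cD p : {for p, continuous D}.
  apply: continuous_normc.
  have cc (f : R * R -> R) : {for p, continuous f} ->
      Ccontinuous_at (fun p => P (f p)) p.
    move=> cf; have [cr ci] := cP (f p); split.
    - exact: (continuous_comp cf cr).
    - exact: (continuous_comp cf ci).
  apply: CcontinuousD; first by apply: cc; exact: cvg_fst.
  have -> : (fun p : R * R => - (q * P p.2)) = (fun p => - q * P p.2).
    by apply/funext => ?; rewrite mulNr.
  by apply: CcontinuousM; [exact: Ccontinuous_cst | apply: cc; exact: cvg_snd].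
have [|c _ cmin] := @compact_EVT_min _ _ D (`[0, 1] `*` `[0, 1])
    _ (compact_setX (@segment_compact R 0 1) (@segment_compact R 0 1))
    (continuous_subspaceT cD).
  by exists (0, 0); split; rewrite /= in_itv /= lexx ler01.
exists (D c).
  by rewrite normc_gt0; apply: curve_neq_q; exact: point_on_curve.
move=> t u; have := cmin (clamp 0 1 t, clamp 0 1 u).
rewrite /D /point /= !(clamp_id (clamp_in _ _)) //; apply.
by apply/mem_set; split; exact: clamp_in.
Qed.

Lemma curve_gap : exists2 e : R, 0 < e & forall t, e <= normc (P t).
Proof.
have [C0 _] := winds0; have [e e0 Pe] := curve_dist pg C0.
by exists e => // t; have := Pe t; rewrite subr0.
Qed.

Let bP : bounded_measurable P. Proof. exact: bounded_measurable_point. Qed.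
Let bV : bounded_measurable (velocity g).
Proof. exact: bounded_measurable_velocity. Qed.
Let cE := contour_intE g.

(** * Branching rule of the integrals *)

Lemma integrandS m n u :
  integrand m.+1 n u = (1 + x m * u) * (integrand m n u * (1 - s * u)^-1).
Proof.
by rewrite /integrand big_ord_recr /= [_ ^+ m.+2]exprSr invfM [u * x m]mulrC; ring.
Qed.

Lemma integrandSr m n u : C u ->
  integrand m n u = (u - s) * (integrand m n.+1 u * (1 - s * u)^-1).
Proof.
move=> uC; rewrite /integrand [_ ^+ n.+1]exprSr.
have := curve_neq_s uC; have := curve_neq_sV uC.
move: (((1 - s * u) / (u - s)) ^+ n) (\prod_(j < m) _ / _) => a b.
move: (1 - s * u) (u - s) => c d c0 d0.
by field; rewrite c0 d0.
Qed.

(* Multiplying by [(1 + u x_m) / (1 - s u)] acts on a block of equal levels as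
   the word identity [W_block], with [p] and [u p] the two letters. *)
Lemma nested_block m n k pre suf H :
  all_tame P pre -> all_tame P suf -> tame_on H ->
  nest (pre ++ nseq k (integrand m.+1 n.+1) ++ suf) H =
  \sum_(l < k.+1) block_coef q s (x m) k l *
    nest (pre ++ nseq (k - l) (integrand m n.+1) ++
          nseq l (integrand m n) ++ suf) H.
Proof.
move=> tpre tsuf tH.
have [e0 e0_gt0 Pe0] := curve_gap; have [e1 e1_gt0 Pe1] := kernel_gap.
(* With this normalisation (1 - s u) p, (u - s) p and (1 + x_m u) p are on the contour the
   integrands of indices (m, n+1), (m, n) and (m+1, n+1). *)
pose p u := integrand m n.+1 u * (1 - s * u)^-1.
pose L (ab : R[i] * R[i]) u := (ab.1 + ab.2 * u) * p u.
pose W w := nest (pre ++ map L w ++ suf) H.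
have tp : tame_on p by apply: bounded_measurableM; [exact: tame_integrand | exact: tame_sV].
have tL ab : tame_on (L ab) by apply: bounded_measurableM => //; exact: tame_linear.
have tmap w : all_tame P (map L w ++ suf).
  by elim: w => [|ab w IH] //=; split.
have Wlin w1 w2 c (a b : R[i] * R[i]) :
    W (w1 ++ (c * a.1 + b.1, c * a.2 + b.2) :: w2) =
    c * W (w1 ++ a :: w2) + W (w1 ++ b :: w2).
  rewrite /W !map_cat -!catA !(catA pre) /=.
  pose cs := [:: (c, L a :: map L w2 ++ suf); (1, L b :: map L w2 ++ suf)].
  have := @nested_prefix _ _ _ _ _ bP bV cE _ _ e0_gt0 e1_gt0 Pe0 Pe1
    (pre ++ map L w1) (L (c * a.1 + b.1, c * a.2 + b.2) :: map L w2 ++ suf) cs H.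
  rewrite !big_cons big_nil /= addr0 mul1r; apply=> //.
  - by apply/all_tame_cat; split=> //; have /all_tame_cat[] := tmap w1.
  - by move=> ? [<-|[<-|[]]] /=; split.
  - move=> H' tH'; rewrite !big_cons big_nil /= addr0 mul1r.
    have -> : L (c * a.1 + b.1, c * a.2 + b.2) = (fun u => c * L a u + L b u).
      by apply/funext => u; rewrite /L /=; ring.
    exact: (@nested_linear _ _ _ _ _ bP bV cE _ _ e0_gt0 e1_gt0 Pe0 Pe1
      _ _ c _ _ (tL a) (tL b) (tmap w2) tH').
have Wexch w1 w2 :
    W (w1 ++ (0, 1) :: (1, 0) :: w2) = q * W (w1 ++ (1, 0) :: (0, 1) :: w2).
  rewrite /W !map_cat -!catA !(catA pre) /=.
  have -> : L (0, 1) = fun u => u * p u by apply/funext => u; rewrite /L /=; ring.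
  have -> : L (1, 0) = p by apply/funext => u; rewrite /L /=; ring.
  have tup : tame_on (fun u => u * p u).
    by apply: bounded_measurableM => //; exact: tame_id.
  pose cs := [:: (q, p :: (fun u => u * p u) :: map L w2 ++ suf)].
  have := @nested_prefix _ _ _ _ _ bP bV cE _ _ e0_gt0 e1_gt0 Pe0 Pe1
    (pre ++ map L w1) ((fun u => u * p u) :: p :: map L w2 ++ suf) cs H.
  rewrite !big_seq1 /=; apply=> //.
  - by apply/all_tame_cat; split=> //; have /all_tame_cat[] := tmap w1.
  - by move=> ? [<-|[]] /=; do 2 split=> //.
  - move=> H' tH'; rewrite big_seq1 /=.
    exact: (@nested_exchange _ _ _ _ _ bP bV cE _ _ e0_gt0 e1_gt0 Pe0 Pe1).
have LP a b f n' : (forall u, C u -> L (a, b) u = f u) ->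
    eq_on_curve P (map L (nseq n' (a, b))) (nseq n' f).
  move=> Lf; rewrite map_nseq; apply: eq_on_curve_nseq => t.
  exact/Lf/point_on_curve.
have := W_block (x m) Wlin Wexch k [::] [::] qq_neq0 ss_neq0; rewrite /= cats0.
have -> : W (nseq k (1, x m)) = nest (pre ++ nseq k (integrand m.+1 n.+1) ++ suf) H.
  apply: (nested_eq _ cE); apply: eq_on_curve_cat; first exact: eq_on_curve_refl.
  apply: eq_on_curve_cat; last exact: eq_on_curve_refl.
  by apply: LP => u _; rewrite integrandS.
move=> ->; apply: eq_bigr => l _; congr (_ * _); rewrite cats0.
rewrite /W map_cat -catA; apply: (nested_eq _ cE).
apply: eq_on_curve_cat; first exact: eq_on_curve_refl.
apply: eq_on_curve_cat.
  apply: LP => u uC; rewrite /L /p /= mulNr; have := curve_neq_sV uC.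
  by move: (1 - s * u) (integrand _ _ _) => c d c0; field.
apply: eq_on_curve_cat; last exact: eq_on_curve_refl.
by apply: LP => u uC; rewrite (integrandSr _ _ uC) /L /p /= mul1r addrC.
Qed.

(** Higher levels stand further out, in accordance with the weak decrease of the exponents
    lambda'_i. *)
Fixpoint level_word m n (b : seq nat) : seq (R[i] -> R[i]) :=
  if b is k :: b' then level_word m n.+1 b' ++ nseq k (integrand m n) else [::].

(** The word just after the expansion, where the variables lowered from one level have not yet been
    merged with those kept at the level below. *)
Fixpoint lowered_word m n (b l : seq nat) : seq (R[i] -> R[i]) :=
  match b, l with
  | k :: b', j :: l' => lowered_word m n.+1 b' l' ++
      nseq (k - j) (integrand m n.+1) ++ nseq j (integrand m n)
  | _, _ => [::]
  end.

Lemma all_tame_level_word m n b : all_tame P (level_word m n b).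
Proof.
elim: b n => //= k b IH n; apply/all_tame_cat; split=> //.
apply: all_tame_nseq; exact: tame_integrand.
Qed.

(** Blocks are expanded starting from the innermost one; [suf] holds those already expanded. *)
Lemma nested_level_word m n b suf H : all_tame P suf -> tame_on H ->
  nest (level_word m.+1 n.+1 b ++ suf) H =
  \sum_(l <- bounded_seqs b)
    (\prod_(c < size b) block_coef q s (x m) (nth 0%N b c) (nth 0%N l c)) *
    nest (lowered_word m n b l ++ suf) H.
Proof.
move=> tsuf tH; elim: b n suf tsuf => [|k b IH] n suf tsuf.
  by rewrite big_seq1 big_ord0 mul1r.
rewrite [level_word _ _ _]/= -catA nested_block //; last exact: all_tame_level_word.
rewrite big_allpairs_dep -[iota 0 k.+1]/(index_iota 0 k.+1) big_mkord.
apply: eq_bigr => j _; rewrite IH; last first.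
  by apply/all_tame_cat; split; [|apply/all_tame_cat; split=> //];
    apply: all_tame_nseq; exact: tame_integrand.
rewrite mulr_sumr; apply: eq_bigr => l _.
by rewrite big_ord_recl /= -!catA mulrA.
Qed.

(** The k - j variables kept at a level join those lowered from the level above. This is path
    conservation in the corresponding column, and what leaves the lowest level is the trailing
    block. *)
Lemma lowered_wordE m n b l : l \in bounded_seqs b ->
  lowered_word m n b l =
  level_word m n.+1 (below_profile b l) ++ nseq (head 0%N l) (integrand m n).
Proof.
elim: b l n => [|k b IH] [|j l] n /bounded_seqsP[// [sl] lb].
have {}IH := IH l n.+1; rewrite [lowered_word _ _ _ _]/= IH; last first.
  rewrite mem_bounded_seqs sl eqxx; apply/forallP => c; exact: (lb c.+1).
have -> : below_profile (k :: b) (j :: l) =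
    (k - j + head 0 l)%N :: below_profile b l.
  rewrite /below_profile /mkseq /= nth0; congr (_ :: _).
  by rewrite -[1%N]/(1 + 0)%N iotaDl -map_comp.
by rewrite /= -!catA; congr (_ ++ _); rewrite addnC nseqD -!catA.
Qed.

(** * Variables of exponent 0, and the case of no variables x_j *)

Definition kernel_prod (ts : seq R) v := \prod_(t <- ts) kern (P t) v.

(** The parameters q and s may be 0, and then the factors P t - q u or 1 - s u are constants without
    a pole; they are collected in [k]. *)
Lemma linear_factors (Q : R[i] -> Prop) (ab : seq (R[i] * R[i])) :
  (forall p, p \in ab -> p.1 != 0) ->
  (forall p, p \in ab -> p.2 != 0 -> Q (p.1 / p.2)) ->
  exists k zs, (forall z, z \in zs -> Q z) /\
    forall u, \prod_(p <- ab) (p.1 - p.2 * u) = k * den zs u.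
Proof.
elim: ab => [|[a b] ab IH] ab0 Qab.
  by exists 1, [::]; split=> // u; rewrite /den !big_nil mulr1.
have [||k [zs [zsQ E]]] := IH.
- by move=> p pab; apply: ab0; rewrite in_cons pab orbT.
- by move=> p pab; apply: Qab; rewrite in_cons pab orbT.
have [b0|b0] := eqVneq b 0.
  exists (a * k), zs; split=> // u; rewrite big_cons /= E b0 mul0r subr0.
  by rewrite mulrA.
exists (- b * k), (a / b :: zs); split=> [z|u].
  rewrite in_cons => /orP[/eqP ->|]; last exact: zsQ.
  exact: (Qab (a, b) (mem_head _ _)).
by rewrite big_cons /= E /den big_cons; field.
Qed.

(* Only the pole at the origin lies inside the contour. *)
Lemma nested_level0 m ts : nest [:: integrand m 0] (kernel_prod ts) = 1.
Proof.
pose p := (\prod_(j < m) (1 + (x j)%:P * 'X)) * \prod_(t <- ts) ((P t)%:P - 'X).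
pose ab := [seq (P t, q) | t <- ts] ++ nseq m.+1 (1, s).
have ab0 r : r \in ab -> r.1 != 0.
  rewrite mem_cat => /orP[/mapP[t _ ->]|/nseqP[-> _]]; last exact: oner_neq0.
  exact/curve_neq0/point_on_curve.
have abQ r : r \in ab -> r.2 != 0 -> winds g 0 (r.1 / r.2).
  rewrite mem_cat => /orP[/mapP[t _ ->]|/nseqP[-> _]] /=; first exact: winds_Cq.
  by rewrite mul1r; exact: winds_sV.
have [k [zs [zs0 E]]] := linear_factors ab0 abQ.
have pE u : p.[u] = (\prod_(j < m) (1 + u * x j)) * \prod_(t <- ts) (P t - u).
  rewrite hornerM !horner_prod; congr (_ * _); apply: eq_bigr => i _.
    by rewrite !hornerE mulrC.
  by rewrite !hornerE.
have abE u : \prod_(r <- ab) (r.1 - r.2 * u) =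
    (\prod_(t <- ts) (P t - q * u)) * (1 - s * u) ^+ m.+1.
  by rewrite big_cat big_map big_nseq iter_mulr_1.
have D0 : k * den zs 0 != 0.
  rewrite -E prodf_seq_neq0; apply/allP => r rab /=.
  by rewrite mulr0 subr0 ab0.
have k0 : k != 0 by apply: contraNneq D0 => ->; rewrite mul0r.
transitivity (cint (fun u => (two_pi_i R)^-1 *
    (u^-1 * ((k^-1 *: p).[u] / den zs u)))).
  apply: eq_contour_int => u uC; rewrite /integrand expr0 mul1r mulr1.
  rewrite /kernel_prod /kernel prodf_div hornerZ pE.
  have dE : den zs u = k^-1 * ((\prod_(t <- ts) (P t - q * u)) * (1 - s * u) ^+ m.+1).
    by rewrite -abE E mulKf.
  rewrite dE; have := @two_pi_i_neq0 R; have := curve_neq0 uC.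
  have : (1 - s * u) ^+ m.+1 != 0 by rewrite expf_neq0 // curve_neq_sV.
  have : \prod_(t <- ts) (P t - q * u) != 0.
    rewrite prodf_seq_neq0; apply/allP => t _ /=; apply: curve_neq_q => //.
    exact: point_on_curve.
  move: (\prod_(t <- ts) _) (\prod_(t <- ts) _) (_ ^+ _) (\prod_(j < m) _) (two_pi_i R).
  by move=> a b c d e a0 c0 u0 e0; field; rewrite a0 c0 u0 e0 k0.
rewrite (contour_intZ pg); last first.
  have [C0 _] := winds0.
  apply: bounded_measurableM.
    by have := tameV pg C0; congr bounded_measurable; apply/funext => t; rewrite subr0.
  apply: bounded_measurableM; first exact: tame_horner.
  by apply: tame_denV => // z /zs0[].
rewrite (cauchy_formula0 pg g01 _ zs0 winds0) mulKf ?two_pi_i_neq0 //.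
rewrite hornerZ pE -mulrA -[k^-1]invrK.
have -> : (k^-1)^-1^-1 = k^-1 by rewrite invrK.
(* At u = 0 numerator and denominator of the kernels have the same value, so the residue is 1. *)
have e : k * den zs 0 = \prod_(t <- ts) P t.
  rewrite -E abE !mulr0 [1 - 0]subr0 expr1n mulr1; apply: eq_bigr => t _.
  by rewrite subr0.
have -> : \prod_(j < m) (1 + 0 * x j) = 1 by apply: big1 => j _; rewrite mul0r addr0.
under eq_bigr do rewrite subr0.
rewrite mul1r -e; move: D0; rewrite mulf_eq0 negb_or => /andP[_ d0].
by field; rewrite k0 d0.
Qed.

(** Variables of level 0 are innermost, so the weight reaching the last of them is a product of
    kernels with outer points, and its integral is 1 wherever these points are. The list [ts] grows
    with each outer variable passed. *)
Lemma nested_drop_level0 m w k ts :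
  nest (w ++ nseq k (integrand m 0)) (kernel_prod ts) = nest w (kernel_prod ts).
Proof.
have cons t ts' : (fun v => kernel_prod ts' v * kern (P t) v) = kernel_prod (t :: ts').
  by apply/funext => v; rewrite /kernel_prod big_cons mulrC.
have one w' : nest (w' ++ [:: integrand m 0]) (kernel_prod ts) = nest w' (kernel_prod ts).
  elim: w' ts => [|f w' IH] ts; first exact: nested_level0.
  rewrite !(nested_cons q cE); congr Cintegral; apply/funext => t.
  by rewrite cons IH.
elim: k w => [|k IH] w; first by rewrite cats0.
by rewrite -[nseq k.+1 _]/([:: integrand m 0] ++ nseq k _) catA IH one.
Qed.

Lemma level_word_cons m n b : ~~ all (pred1 0%N) b ->
  exists k w, level_word m n.+1 b = integrand m k.+1 :: w /\ all_tame P w.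
Proof.
elim: b n => //= k b IH n; rewrite negb_and.
have [b0|bN] := boolP (all (pred1 0%N) b); last first.
  move=> _; have [j [w [-> tw]]] := IH n.+1 bN.
  exists j, (w ++ nseq k (integrand m n.+1)); split=> //.
  apply/all_tame_cat; split=> //; apply: all_tame_nseq; exact: tame_integrand.
rewrite orbF; case: k => // k _; exists n, (nseq k (integrand m n.+1)); split.
  have -> : level_word m n.+2 b = [::].
    by elim: b n {IH} b0 => //= j b IH n /andP[/eqP -> /IH ->].
  by [].
by apply: all_tame_nseq; exact: tame_integrand.
Qed.

(* All poles of the outermost integrand lie inside the contour, and it is
   O(u^-2) at infinity. *)
Lemma nested_level_word0 b :
  nest (level_word 0 1 b) (fun=> 1) = (all (pred1 0%N) b)%:R.
Proof.
have [b0|bN] := boolP (all _ b).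
  have -> : level_word 0 1 b = [::] by elim: b (1%N) b0 => //= j b IH n /andP[/eqP -> /IH ->].
  by [].
have [k [w [-> tw]]] := level_word_cons 0 0 bN.
have [e0 e0_gt0 Pe0] := curve_gap; have [e1 e1_gt0 Pe1] := kernel_gap.
rewrite (nested_cons q cE).
apply: (@nested_front_vanish _ _ _ _ _ bP bV cE _ _ e0_gt0 e1_gt0 Pe0 Pe1 w
  (fun u => integrand 0 k.+1 u * 1) (fun=> 1)) => //.
- by apply: bounded_measurableM; [exact: tame_integrand | exact: tame_cst].
- exact: tame_cst.
move=> vs.
(* One factor 1 - s u is cancelled by the denominator 1 - s u of the case m = 0. So the degree is at
   most k + |vs|, against k + 2 + |vs| poles, the pole at 0 coming from du / u. *)
pose p := (1 - s%:P * 'X) ^+ k * \prod_(v <- vs) ('X - (P v)%:P).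
pose zs := 0 :: nseq k.+1 s ++ [seq q * P v | v <- vs].
have zsW z : z \in zs -> winds g (two_pi_i R) z.
  rewrite in_cons mem_cat => /or3P[/eqP ->|/nseqP[-> _]|/mapP[v _ ->]].
  - exact: winds0.
  - exact: winds_s.
  - exact/winds_qC/point_on_curve.
have szp : (size p < size zs)%N.
  rewrite /= size_cat size_nseq size_map ltnS.
  apply: leq_trans (size_polyMleq _ _) _.
  have s1 : (size (1 - s%:P * 'X : {poly R[i]})%R <= 2)%N.
    apply: leq_trans (size_polyD _ _) _; rewrite size_poly1 size_polyN geq_max /=.
    by apply: leq_trans (size_polyMleq _ _) _; rewrite size_polyX size_polyC; case: eqP.
  have sk : (size ((1 - s%:P * 'X) ^+ k)%R <= k.+1)%N.
    apply: leq_trans (size_poly_exp_leq _ _) _; rewrite ltnS.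
    rewrite -[leqRHS]mul1n leq_mul2r.
    by case: (size _) s1 => [|[|[|]]] // _; rewrite orbT.
  rewrite size_prod_XsubC.
  by rewrite addnS; exact: (leq_add sk (leqnn _)).
rewrite -[RHS](mulr0 (two_pi_i R)^-1).
rewrite -(contour_int_rational pg g01 zsW (or_introl szp)) -(contour_intZ pg); last first.
  apply: bounded_measurableM; first exact: tame_horner.
  by apply: tame_denV => // z /zsW[].
rewrite contour_intE; congr Cintegral; apply/funext => t; rewrite /cauchy_weight mulrA.
congr (_ * _); have uC := point_on_curve g t; move: (P t) uC => u uC.
rewrite /integrand big_ord0 /kernel prodf_div mulr1 expr1.
have -> : p.[u] = (1 - s * u) ^+ k * \prod_(v <- vs) (u - P v).
  rewrite hornerM horner_exp horner_prod !hornerE; congr (_ * _).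
  by apply: eq_bigr => v _; rewrite hornerXsubC.
have -> : den zs u = u * ((u - s) ^+ k.+1 * \prod_(v <- vs) (u - q * P v)).
  by rewrite /den big_cons subr0 big_cat big_nseq iter_mulr_1 big_map.
rewrite expr_div_n [(1 - s * u) ^+ k.+1]exprSr.
have := @two_pi_i_neq0 R; have := curve_neq0 uC; have := curve_neq_sV uC.
have : (u - s) ^+ k.+1 != 0 by rewrite expf_neq0 // curve_neq_s.
have : \prod_(v <- vs) (u - q * P v) != 0.
  rewrite prodf_seq_neq0; apply/allP => v _ /=; apply: curve_neq_q => //.
  exact: point_on_curve.
move: (1 - s * u) (\prod_(v <- vs) _) (\prod_(v <- vs) _) (_ ^+ k.+1) (_ ^+ k) (two_pi_i R).
by move=> y N D c d f D0 c0 y0 u0 f0; field; rewrite D0 c0 y0 u0 f0.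
Qed.

Lemma branching_nested m b :
  branching q s m x b = nest (level_word m 1 b) (fun=> 1).
Proof.
elim: m b => [|m IH] b; first by rewrite nested_level_word0.
rewrite -[level_word _ _ _]cats0 nested_level_word //; last exact: tame_cst.
rewrite [LHS]/= [LHS]big_seq [RHS]big_seq; apply: eq_bigr => l lb.
congr (_ * _); rewrite cats0 IH lowered_wordE //.
have -> : (fun=> 1) = kernel_prod [::].
  by apply/funext => v; rewrite /kernel_prod big_nil.
by rewrite nested_drop_level0.
Qed.

(** The difference lambda_c - lambda_(c+1) counts the i with lambda'_i = c. Putting a largest part k
    in front raises lambda'_i by one for all i < k: old positions go up one level, and the new ones
    form the block of the lowest level. *)
Lemma level_word_conj_part m n la : sorted geq la ->
  level_word m n.+1 (profile la) =
  mkseq (fun i => integrand m (n + conj_part la i)%N) (head 0%N la).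
Proof.
elim: la n => // k la IH n sla.
have {}IH := IH n.+1 (path_sorted sla).
have lak : (head 0%N la <= k)%N by case: (la) sla => //= a l /andP[].
have conj0 i : (head 0%N la <= i)%N -> conj_part la i = 0%N.
  move=> lei; apply/eqP; rewrite -leqn0 leqNgt -has_count; apply/hasPn => j jla.
  rewrite -leqNgt; apply: leq_trans lei.
  move: (path_sorted sla) jla; case: (la) => //= a l al; rewrite in_cons.
  case/orP => [/eqP -> //|jl].
  have tr : transitive geq by move=> a1 a2 a3 h1 h2; exact: leq_trans h2 h1.
  by have /allP/(_ _ jl) := order_path_min tr al.
have -> : profile (k :: la) = (k - head 0 la)%N :: profile la.
  rewrite /profile /mkseq /= nth0; congr (_ :: _).
  by rewrite -[1%N]/(1 + 0)%N iotaDl -map_comp.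
have kE : iota 0 k = iota 0 (head 0 la)%N ++ iota (head 0 la)%N (k - head 0 la)%N.
  by rewrite -[in LHS](subnKC lak) iotaD add0n.
rewrite [LHS]/= IH /mkseq [head 0%N (k :: la)]/= kE map_cat; congr (_ ++ _).
  apply/eq_in_map => i; rewrite mem_iota add0n => /andP[_ il].
  by rewrite /conj_part /= (leq_trans il lak) addSnnS.
apply: (@eq_from_nth _ id); rewrite ?size_nseq ?size_map ?size_iota ?addn0 // => i il.
rewrite nth_nseq il (nth_map 0%N) ?size_iota // nth_iota //.
rewrite /conj_part /= -/(conj_part la _) conj0 ?leq_addr // addn0.
by rewrite -ltn_subRL il addn1.
Qed.

(** The constant [c] and the weight [H] carry the induction: once the outermost variable is fixed,
    its own factor is a constant and its kernels with the inner variables join the weight. *)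
Lemma iter_contour_int_nested n (phi : nat -> R[i] -> R[i]) H c :
  (forall i, tame_on (phi i)) -> tame_on H ->
  iter_contour_int g (fun u : n.-tuple R[i] => c *
    ((\prod_(i < n) \prod_(j < n | (i < j)%N) kern (tnth u i) (tnth u j)) *
     \prod_(i < n) (phi i (tnth u i) * H (tnth u i)))) =
  c * nest (mkseq phi n) H.
Proof.
elim: n phi H c => [|n IH] phi H c tphi tH; first by rewrite /= !big_ord0 mulr1.
have [e0 e0_gt0 Pe0] := curve_gap; have [e1 e1_gt0 Pe1] := kernel_gap.
have -> : mkseq phi n.+1 = phi 0%N :: mkseq (phi \o succn) n.
  by rewrite /mkseq /= -[1%N]/(1 + 0)%N iotaDl -map_comp.
have tseq k (psi : nat -> R[i] -> R[i]) :
    (forall i, tame_on (psi i)) -> all_tame P (mkseq psi k).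
  by rewrite /mkseq => tpsi; elim: (iota 0 k) => //= i r IHr; split.
have tint : tame_on (fun u => (two_pi_i R * u)^-1 * (phi 0%N u * H u *
    nest (mkseq (phi \o succn) n) (fun v => H v * kern u v))).
  apply: bounded_measurableM.
    have [C0 _] := winds0.
    have := bounded_measurableZ (two_pi_i R)^-1 (tameV pg C0).
    by congr bounded_measurable; apply/funext => t; rewrite subr0 [RHS]invfM.
  apply: bounded_measurableM.
    by apply: bounded_measurableM => //; exact: (tphi 0%N).
  apply: (@bounded_measurable_nested _ _ _ _ _ bP bV cE _ _ e0_gt0 e1_gt0 Pe0 Pe1
    _ _ _ _ (fun t v => H v * kern (P t) v)).
    by apply: tseq => i; exact: tphi.
  apply: bounded_measurableM; last exact: (bounded_measurable_kernel bP e1_gt0 Pe1).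
  by apply: bounded_measurable_comp tH; exact: measurable_snd.
rewrite -[nest (_ :: _) H]/(cint _) -(contour_intZ pg _ tint).
apply: eq_contour_int => u uC.
have [t ut] := curve_imageP uC.
have tHu : tame_on (fun v => H v * kern u v).
  by rewrite ut; exact: (tame_kernel bP e1_gt0 Pe1).
rewrite mulrCA; congr (_ * _).
rewrite mulrA -(IH (phi \o succn) _ _ (fun i => tphi i.+1) tHu).
congr iter_contour_int; apply/funext => us; rewrite -mulrA; congr (_ * _).
rewrite !big_ord_recl tnth0.
rewrite big_mkcond big_ord_recl /= mul1r.
have E1 : \prod_(i < n) kern u (tnth [tuple of u :: us] (lift ord0 i)) =
    \prod_(i < n) kern u (tnth us i) by apply: eq_bigr => i _; rewrite tnthS.
have E2 : \prod_(i < n) \prod_(j < n.+1 | (lift ord0 i < j)%N)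
      kern (tnth [tuple of u :: us] (lift ord0 i)) (tnth [tuple of u :: us] j) =
    \prod_(i < n) \prod_(j < n | (i < j)%N) kern (tnth us i) (tnth us j).
  apply: eq_bigr => i _; rewrite big_mkcond big_ord_recl /= mul1r [RHS]big_mkcond.
  by apply: eq_bigr => j _; rewrite !tnthS.
have E3 : \prod_(i < n) (phi (lift ord0 i) (tnth [tuple of u :: us] (lift ord0 i)) *
      H (tnth [tuple of u :: us] (lift ord0 i))) =
    \prod_(i < n) (phi i.+1 (tnth us i) * H (tnth us i)).
  by apply: eq_bigr => i _; rewrite tnthS.
rewrite E1 E2 E3 [in RHS](eq_bigr _ (fun i _ => mulrA _ _ _)) [in RHS]big_split /=.
ring.
Qed.

End IntegralRepresentation.

Theorem theorem8p1 (R : realType) (q s : R[i]) (hq : `|q| < 1) (hs : `|s| < 1)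
    (m : nat) (hm : (0 < m)%N) (la : seq nat) (hla : is_partition la)
    (hlen : (size la <= m)%N) (x : 'I_m -> R[i]) (g : R -> R[i])
    (hg : pos_closed_contour g)
    (hsV : s != 0 -> outside g s^-1)
    (h0 : inside g 0)
    (hsq : forall i : nat, inside g (s * q ^+ i))
    (hqC : forall z, curve_image g z -> inside g (q * z)) :
  spin_qWhittaker q s la x =
  iter_contour_int g (fun u : (head 0%N la).-tuple R[i] =>
    (\prod_(i < head 0%N la) \prod_(j < head 0%N la | (i < j)%N)
       ((tnth u i - tnth u j) / (tnth u i - q * tnth u j))) *
    \prod_(i < head 0%N la)
       (((1 - s * tnth u i) / (tnth u i - s)) ^+ conj_part la i *
        ((\prod_(j < m) (1 + tnth u i * x j)) /
         (1 - s * tnth u i) ^+ m.+1))).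
Proof.
(* The recursion on m needs one sequence of variables independent of m; the default 0 is never
   reached by an index below m. *)
pose xs j := if insub j is Some i then x i else 0.
have xE : x = fun i : 'I_m => xs i by apply/funext => i; rewrite /xs valK.
have /andP[sla _] := hla.
have tF := tame_integrand xs hg hsV hsq m.
rewrite {1}xE (spin_qWhittaker_branching (qq_neq0 hq) (ss_neq0 hq hs)).
rewrite (branching_nested xs hq hs hg hsV h0 hsq hqC).
rewrite (level_word_conj_part _ _ _ _ sla).
rewrite -[LHS]mul1r -(iter_contour_int_nested hg h0 hqC) //.
- congr iter_contour_int; apply/funext => u; rewrite mul1r; congr (_ * _).
  apply: eq_bigr => i _; rewrite mulr1 /integrand.
  congr (_ * (_ / _)); apply: eq_bigr => j _.
  by rewrite (congr1 (fun f => f j) xE).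
- exact: tame_cst.
Qed.
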